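(* If $M$ is a smooth real affine algebraic variety (regarded as an affine Nash manifold), then $\mathcal{S}(M)$ equals the space of smooth functions $\phi$ on $M$ such that $D\phi$ is bounded for every algebraic differential operator $D$ on $M$. In particular, $\mathcal{S}(\mathbb{R}^n)$ is the space of classical Schwartz functions on $\mathbb{R}^n$.
   Context: A subset of $\mathbb{R}^n$ is semi-algebraic if it is a finite union of sets each defined by finitely many polynomial equations $g=0$ and strict inequalities $f>0$ with real coefficients; a map between semi-algebraic sets is semi-algebraic if its graph is. A Nash submanifold of $\mathbb{R}^n$ is a semi-algebraic subset which is a smooth submanifold; a Nash function on it is a smooth ($C^\infty$) semi-algebraic real function; Nash maps are smooth semi-algebraic maps. An affine Nash manifold is a space identified, up to Nash diffeomorphism, with a closed Nash submanifold of some $\mathbb{R}^n$; a smooth affine algebraic variety over $\mathbb{R}$ (its set of real points) is an affine Nash manifold. A Nash vector field is a Nash section of the tangent bundle. The algebra of Nash differential operators on an affine Nash manifold $M$ is the unital subalgebra of $\mathrm{Hom}_{\mathbb{R}}(C^\infty(M),C^\infty(M))$ generated by multiplications by Nash functions and derivations along Nash vector fields. $\mathcal{S}(M)$ is the space of $\phi\in C^\infty(M)$ such that $D\phi$ is bounded for every Nash differential operator $D$ on $M$. For a smooth real affine algebraic variety $M$, the algebra of algebraic differential operators on $M$ is the unital subalgebra of $\mathrm{Hom}_{\mathbb{R}}(C^\infty(M),C^\infty(M))$ generated by multiplications by polynomial functions and derivations along algebraic vector fields. *)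

(* Defs.v *)
From HB Require Import structures.
From mathcomp Require Import all_boot all_order all_algebra.
From mathcomp Require Import all_classical all_reals all_analysis.
(* The notations of [mpoly] clash with those of MathComp-Analysis. *)
From mathcomp Require Import -(notations) mpoly.

Set Implicit Arguments.
Unset Strict Implicit.
Unset Printing Implicit Defensive.

Import Order.TTheory GRing.Theory Num.Theory numFieldNormedType.Exports.

Local Open Scope classical_set_scope.
Local Open Scope ring_scope.

(* C^k for a map on an open set [U] of a finite-dimensional space [V], by
   iterated directional derivatives. *)
Fixpoint Ck_on (R : realType) (V W : normedModType R) (k : nat)
    (U : set V) (F : V -> W) : Prop :=
  match k with
  | 0%N => forall x, U x -> {for x, continuous F}
  | k'.+1 => (forall x, U x -> {for x, continuous F}) /\
      forall v : V, (forall x, U x -> derivable F x v) /\ Ck_on k' U ('D_v F)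
  end.

Definition smooth_on (R : realType) (V W : normedModType R)
    (U : set V) (F : V -> W) : Prop := forall k, Ck_on k U F.

Definition semialgebraic (R : realType) (n : nat) (A : set 'rV[R]_n) : Prop :=
  exists s : seq (seq (mpoly n R) * seq (mpoly n R)),
    A = [set x | has (fun gf => all (fun g => meval (x 0) g == 0) gf.1 &&
                                all (fun f => 0 < meval (x 0) f) gf.2) s].

(* In the definitions below [M] is meant to be a closed Nash submanifold of
   R^n. *)

Definition local_extension (R : realType) (n : nat) (M : set 'rV[R]_n)
    (W : normedModType R) (f : M -> W) (x : M)
    (U : set 'rV[R]_n) (F : 'rV[R]_n -> W) : Prop :=
  [/\ open U, U (val x), smooth_on U F & forall y : M, U (val y) -> F (val y) = f y].

Definition smooth (R : realType) (n : nat) (M : set 'rV[R]_n)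
    (W : normedModType R) (f : M -> W) : Prop :=
  forall x : M, exists U F, local_extension f x U F.

Definition semialgebraic_map (R : realType) (n m : nat) (M : set 'rV[R]_n)
    (f : M -> 'rV[R]_m) : Prop :=
  semialgebraic [set row_mx (val x) (f x) | x in [set: M]].

(* Real-valued functions are identified with maps to R^1. *)
Definition nash_function (R : realType) (n : nat) (M : set 'rV[R]_n)
    (f : M -> R) : Prop :=
  smooth f /\ semialgebraic_map (fun x => const_mx (f x) : 'rV[R]_1).

(* Velocities at [x] of smooth curves in [M]. *)
Definition tangent (R : realType) (n : nat) (M : set 'rV[R]_n) (x : 'rV[R]_n)
    : set 'rV[R]_n :=
  [set v : 'rV[R]_n | exists (J : set R) (c : R -> 'rV[R]_n),
    [/\ open J /\ J 0, smooth_on J c, c @` J `<=` M, c 0 = x & c^`()%classic 0 = v]].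

Definition nash_vector_field (R : realType) (n : nat) (M : set 'rV[R]_n)
    (v : M -> 'rV[R]_n) : Prop :=
  [/\ smooth v, semialgebraic_map v & forall x : M, tangent M (val x) (v x)].

Record Cinf (R : realType) (n : nat) (M : set 'rV[R]_n) := MkCinf {
  Cinf_fun :> M -> R;
  Cinf_smooth : smooth Cinf_fun
}.

Definition multiplication_by (R : realType) (n : nat) (M : set 'rV[R]_n)
    (g : M -> R) (D : Cinf M -> Cinf M) : Prop :=
  forall (phi : Cinf M) (x : M), D phi x = g x * phi x.

(* For [v] tangent to [M], the value does not depend on the extension. *)
Definition derivation_along (R : realType) (n : nat) (M : set 'rV[R]_n)
    (v : M -> 'rV[R]_n) (D : Cinf M -> Cinf M) : Prop :=
  forall (phi : Cinf M) (x : M) U F, local_extension phi x U F ->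
    D phi x = 'D_(v x) F (val x).

(* The operations are those of Hom_R(C^oo(M), C^oo(M)); linearity is inherited
   from the generators. *)
Inductive generated_algebra (R : realType) (n : nat) (M : set 'rV[R]_n)
    (G : set (Cinf M -> Cinf M)) : (Cinf M -> Cinf M) -> Prop :=
| gen_base D : G D -> generated_algebra G D
| gen_one : generated_algebra G idfun
| gen_add D1 D2 (D : Cinf M -> Cinf M) : generated_algebra G D1 -> generated_algebra G D2 ->
    (forall (phi : Cinf M) (x : M), D phi x = D1 phi x + D2 phi x) ->
    generated_algebra G D
| gen_scale (a : R) D1 (D : Cinf M -> Cinf M) : generated_algebra G D1 ->
    (forall (phi : Cinf M) (x : M), D phi x = a * D1 phi x) ->
    generated_algebra G D
| gen_comp D1 D2 : generated_algebra G D1 -> generated_algebra G D2 ->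
    generated_algebra G (D1 \o D2).

Definition nash_diffop (R : realType) (n : nat) (M : set 'rV[R]_n)
    : set (Cinf M -> Cinf M) :=
  generated_algebra
    [set D | (exists2 g, nash_function g & multiplication_by g D) \/
             (exists2 v, nash_vector_field v & derivation_along v D)].

Definition schwartz_space (R : realType) (n : nat) (M : set 'rV[R]_n)
    : set (Cinf M) :=
  [set phi | forall D, nash_diffop D -> bounded_fun (D phi)].
Arguments schwartz_space {R n} M.

Definition zero_locus (R : realType) (n k : nat) (f : 'I_k -> mpoly n R)
    : set 'rV[R]_n :=
  [set x | forall j, meval (x 0) (f j) = 0].

Definition in_ideal (R : realType) (n k : nat) (f : 'I_k -> mpoly n R)
    (p : mpoly n R) : Prop :=
  exists a : 'I_k -> mpoly n R, p = \sum_(j < k) a j * f j.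

Definition jacobian (R : realType) (n c : nat) (g : 'I_c -> mpoly n R)
    (x : 'rV[R]_n) : 'M[R]_(c, n) :=
  \matrix_(i, j) meval (x 0) (mderiv j (g i)).

(* Smoothness of Spec R[X_1..X_n]/(f) along its real points, by the Jacobian
   criterion: near [x] the ideal (f) is generated by members [g] having
   linearly independent differentials at [x].  Points that are not real carry
   no condition, so that besides the schemes smooth over R this includes every
   nonsingular real algebraic set ([f] then generating its ideal). *)
Definition smooth_variety (R : realType) (n k : nat) (f : 'I_k -> mpoly n R)
    : Prop :=
  forall x, zero_locus f x ->
    exists (c : nat) (g : 'I_c -> mpoly n R) (h : mpoly n R),
      [/\ forall i, in_ideal f (g i), row_free (jacobian g x),
          meval (x 0) h != 0 & forall j, in_ideal g (h * f j)].

Definition polynomial_function (R : realType) (n : nat) (M : set 'rV[R]_n)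
    (f : M -> R) : Prop :=
  exists p : mpoly n R, forall x : M, f x = meval (val x 0) p.

Definition algebraic_vector_field (R : realType) (n : nat) (M : set 'rV[R]_n)
    (v : M -> 'rV[R]_n) : Prop :=
  (forall i, polynomial_function (fun x => v x 0 i)) /\
  (forall x : M, tangent M (val x) (v x)).

Definition algebraic_diffop (R : realType) (n : nat) (M : set 'rV[R]_n)
    : set (Cinf M -> Cinf M) :=
  generated_algebra
    [set D | (exists2 g, polynomial_function g & multiplication_by g D) \/
             (exists2 v, algebraic_vector_field v & derivation_along v D)].

Definition partial (R : realType) (n : nat) (i : 'I_n) (f : 'rV[R]_n -> R)
    : 'rV[R]_n -> R :=
  'D_(delta_mx 0 i) f.

Definition partials (R : realType) (n : nat) (b : multinom n)
    (f : 'rV[R]_n -> R) : 'rV[R]_n -> R :=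
  foldr (fun i => iter (b i) (partial i)) f (enum 'I_n).

Definition classical_schwartz (R : realType) (n : nat) : set ('rV[R]_n -> R) :=
  [set f : 'rV[R]_n -> R | smooth_on setT f /\
    forall a b : multinom n,
      bounded_fun (fun x : 'rV[R]_n => (\prod_(i < n) x 0 i ^+ a i) * partials b f x)].
Arguments classical_schwartz R n : clear implicits.

(* Main.v *)
Require Import Defs.
From HB Require Import structures.
From mathcomp Require Import all_boot all_order all_algebra.
From mathcomp Require Import all_classical all_reals all_analysis.
From mathcomp Require Import -(notations) mpoly.
From mathcomp Require Import polyrcf ordered_qelim qe_rcf.
From mathcomp Require Import ring lra.

(** A Nash function on a closed semialgebraic set is bounded by a polynomial, and a Nash
operator on a smooth variety is a combination of algebraic operators with Nash
coefficients on the left.  So if all algebraic operators send [phi] to bounded functions,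
then [a * D phi] is bounded for [a] Nash and [D] algebraic, because [a] is dominated by a
polynomial [p] and [p * D] is algebraic; hence all Nash operators send [phi] to bounded
functions.  The converse inclusion holds because algebraic operators are Nash
([algebraic_nash_diffop]).

The polynomial bound ([nash_function_poly_bound]) comes from semialgebraic sets in the
plane ([semialgebraic_growth]).  It uses the Tarski-Seidenberg theorem, which is deduced from
quantifier elimination for real closed fields ([semialgebraic_exists]).

For the combination ([nash_diffop_combination]), two facts are needed.  First, coefficients
can be moved to the left of an algebraic operator by Leibniz' rule; this asks that
derivatives of Nash functions along algebraic fields are Nash ([directional_nash]), again a
consequence of Tarski-Seidenberg.  Second, a Nash vector field [v] is a combination of
algebraic ones.  By the Jacobian criterion the projection onto the tangent space at a
point is locally a rational function: with [G] the Jacobian matrix of local equations it is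
[1 - G^T (G G^T)^-1 G].  The polynomials [Q] for which [Q] times the projection extends to a
polynomial matrix with tangent rows on the whole variety form an ideal without real zeros on
the variety.  A finite part of an ideal has the same zeros ([ideal_zeros_finite], by Dickson's
lemma), and a sum of squares gives such a [Q] that is positive everywhere, with matrix [W]
([spanning_tangent_matrix]).  Then [v = sum_i (v_i / Q) W_i], and the [v_i / Q] are Nash.

Tangent vectors are velocities of smooth curves.  That every vector killed by the
differentials of the equations is one is the implicit function theorem, proved for
polynomial equations by a contraction argument ([polynomial_fixed_point_curve],
[complete_intersection_curve]).

For the affine space, the variety without equations, an algebraic operator is built from
polynomials and partial derivatives.  As partial derivatives commute, the classical
conditions give bounds for all polynomial weights and all words of partial derivatives
([rapidly_decreasing]), and these are stable under algebraic operators. *)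

Import Order.TTheory GRing.Theory Num.Theory numFieldNormedType.Exports.
Set Implicit Arguments.
Unset Strict Implicit.
Unset Printing Implicit Defensive.
Local Open Scope classical_set_scope.
Local Open Scope ring_scope.

(** * Functions of class C^k on open sets *)

Section CkBasics.
Variable R : realType.
Implicit Types V W : normedModType R.

Lemma near_eq_on V W (U : set V) (F G : V -> W) x : open U -> U x ->
  (forall y, U y -> F y = G y) -> {near x, F =1 G}.
Proof.
move=> oU Ux FG; near=> y; apply: FG; near: y; exact: open_nbhs_nbhs.
Unshelve. all: end_near. Qed.

Lemma continuous_eq_on V W (U : set V) (F G : V -> W) x : open U -> U x ->
  (forall y, U y -> F y = G y) -> {for x, continuous F} -> {for x, continuous G}.
Proof.
move=> oU Ux FG cF; rewrite /prop_for /continuous_at -FG //.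
exact: cvg_trans (near_eq_cvg (near_eq_on oU Ux FG)) cF.
Qed.

Lemma derivable_eq_on V W (U : set V) (F G : V -> W) x v : open U -> U x ->
  (forall y, U y -> F y = G y) -> derivable F x v -> derivable G x v.
Proof. by move=> oU Ux FG; apply: near_eq_derivable; exact: near_eq_on FG. Qed.

Lemma derive_eq_on V W (U : set V) (F G : V -> W) x v : open U -> U x ->
  (forall y, U y -> F y = G y) -> 'D_v F x = 'D_v G x.
Proof. by move=> oU Ux FG; apply: near_eq_derive; exact: near_eq_on FG. Qed.

Lemma Ck_pred V W k (U : set V) (F : V -> W) : Ck_on k.+1 U F -> Ck_on k U F.
Proof.
elim: k F => [|k IH] F [cF dF] //; split=> // v.
by have [? /IH] := dF v.
Qed.

(** Openness of [U] matters: derivatives at a point of [U] only see nearby points, so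
that functions agreeing on [U] may be exchanged. *)
Lemma Ck_eq_on V W k (U : set V) (F G : V -> W) : open U ->
  (forall x, U x -> F x = G x) -> Ck_on k U F -> Ck_on k U G.
Proof.
move=> oU; elim: k F G => [|k IH] F G FG.
  by move=> cF x Ux; apply: continuous_eq_on FG (cF x Ux).
move=> [cF dF]; split=> [x Ux|v]; first exact: continuous_eq_on FG (cF x Ux).
have [dFv CF] := dF v; split=> [x Ux|]; first exact: derivable_eq_on FG (dFv x Ux).
by apply: IH CF => x Ux; exact: derive_eq_on FG.
Qed.

Lemma Ck_sub V W k (U U' : set V) (F : V -> W) : U' `<=` U -> Ck_on k U F -> Ck_on k U' F.
Proof.
move=> sU; elim: k F => [|k IH] F; first by move=> cF x /sU /cF.
move=> [cF dF]; split=> [x /sU /cF //|v]; have [dFv CF] := dF v.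
by split=> [x /sU /dFv //|]; exact: IH.
Qed.

(** Together with [Ck_eq_on] this lets smoothness be checked on local formulas, as is
needed for functions given by local extensions. *)
Lemma Ck_local V W k (U : set V) (F : V -> W) :
  (forall x, U x -> exists U', [/\ open U', U' x & Ck_on k U' F]) -> Ck_on k U F.
Proof.
elim: k F => [|k IH] F h; first by move=> x /h[U' [_ U'x /(_ x U'x)]].
split=> [x /h[U' [_ U'x [cF _]]]|v]; first exact: cF.
split=> [x /h[U' [_ U'x [_ /(_ v)[dF _]]]]|]; first exact: dF.
by apply: IH => x /h[U' [oU' U'x [_ /(_ v)[_ CF]]]]; exists U'.
Qed.

Lemma smooth_on_eq V W (U : set V) (F G : V -> W) : open U ->
  (forall x, U x -> F x = G x) -> smooth_on U F -> smooth_on U G.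
Proof. by move=> oU FG sF k; exact: Ck_eq_on FG (sF k). Qed.

Lemma smooth_on_sub V W (U U' : set V) (F : V -> W) :
  U' `<=` U -> smooth_on U F -> smooth_on U' F.
Proof. by move=> sU sF k; exact: Ck_sub (sF k). Qed.

Lemma smooth_on_local V W (U : set V) (F : V -> W) :
  (forall x, U x -> exists U' G, [/\ open U', U' x, smooth_on U' G &
     forall y, U' y -> F y = G y]) -> smooth_on U F.
Proof.
move=> h k; apply: Ck_local => x /h[U' [G [oU' U'x sG FG]]].
by exists U'; split=> //; apply: Ck_eq_on (sG k) => // y /FG.
Qed.

Lemma smooth_on_derivable V W (U : set V) (F : V -> W) x v :
  smooth_on U F -> U x -> derivable F x v.
Proof. by move=> /(_ 1%N)[_ /(_ v)[dF _]]; exact: dF. Qed.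

Lemma smooth_on_derive V W (U : set V) (F : V -> W) v :
  smooth_on U F -> smooth_on U ('D_v F).
Proof. by move=> sF k; have [_ /(_ v)[]] := sF k.+1. Qed.

Lemma smooth_on_continuous V W (U : set V) (F : V -> W) x :
  smooth_on U F -> U x -> {for x, continuous F}.
Proof. by move=> /(_ 0%N); exact. Qed.

(** The usual way to prove smoothness at once for all orders: exhibit a class of
differentiable functions that contains its own directional derivatives. *)
Lemma smooth_on_class V W (U : set V) (E : set (V -> W)) : open U ->
  (forall F x, E F -> U x -> {for x, continuous F}) ->
  (forall F x v, E F -> U x -> derivable F x v) ->
  (forall F v, E F -> exists2 G, E G & forall x, U x -> G x = 'D_v F x) ->
  forall F, E F -> smooth_on U F.
Proof.
move=> oU cE dE DE F EF k; elim: k F EF => [|k IH] F EF; first by move=> x; exact: cE.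
split=> [x|v]; first exact: cE.
split=> [x|]; first exact: dE.
by have [G EG GD] := DE F v EF; apply: Ck_eq_on (IH _ EG).
Qed.

Lemma smooth_on_cst V W (U : set V) (c : W) : open U -> smooth_on U (fun _ => c).
Proof.
move=> oU; apply: (@smooth_on_class _ _ _ [set F | exists c, F = fun _ => c]) => //.
- by move=> F x [d ->] _; exact: cst_continuous.
- by move=> F x v [d ->] _; exact: derivable_cst.
- move=> F v [d ->]; exists (fun _ => 0); first by exists 0.
  by move=> x _; rewrite derive_cst.
- by exists c.
Qed.

Lemma smooth_on_id V (U : set V) : open U -> smooth_on U (@id V).
Proof.
move=> oU; pose E : set (V -> V) := [set F | F = id \/ exists c, F = fun _ => c].
apply: (@smooth_on_class V V U E oU) => [F x|F x v|F v|]; last by left.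
- by move=> [->|[d ->]] _; [exact: id|exact: cst_continuous].
- by move=> [->|[d ->]] _; [exact: derivable_id|exact: derivable_cst].
- move=> [->|[d ->]].
    by exists (fun _ => v) => [|x _]; [right; exists v|rewrite derive_id].
  by exists (fun _ => 0) => [|x _]; [right; exists 0|rewrite derive_cst].
Qed.

Lemma Ck_onD V W k (U : set V) (F G : V -> W) : open U ->
  Ck_on k U F -> Ck_on k U G -> Ck_on k U (fun x => F x + G x).
Proof.
move=> oU; elim: k F G => [|k IH] F G.
  by move=> cF cG x Ux; apply: continuousD; [exact: cF|exact: cG].
move=> [cF dF] [cG dG]; split=> [x Ux|v].
  by apply: continuousD; [exact: cF|exact: cG].
have [dFv CF] := dF v; have [dGv CG] := dG v; split=> [x Ux|].
  by apply: derivableD; [exact: dFv|exact: dGv].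
apply: Ck_eq_on (IH _ _ CF CG) => // x Ux.
by rewrite -deriveD; [|exact: dFv|exact: dGv].
Qed.

(** By induction on [k] from Leibniz' rule; the factors themselves are needed one order
lower, hence [Ck_pred]. *)
Lemma Ck_onM V k (U : set V) (F G : V -> R) : open U ->
  Ck_on k U F -> Ck_on k U G -> Ck_on k U (fun x => F x * G x).
Proof.
move=> oU; elim: k F G => [|k IH] F G.
  by move=> cF cG x Ux; apply: continuousM; [exact: cF|exact: cG].
move=> CF' CG'; move: (CF') (CG') => [cF dF] [cG dG]; split=> [x Ux|v].
  by apply: continuousM; [exact: cF|exact: cG].
have [dFv CF] := dF v; have [dGv CG] := dG v; split=> [x Ux|].
  by apply: derivableM; [exact: dFv|exact: dGv].
apply: Ck_eq_on (Ck_onD oU (IH _ _ (Ck_pred CF') CG) (IH _ _ (Ck_pred CG') CF)) => // x Ux.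
by rewrite deriveM; [|exact: dFv|exact: dGv].
Qed.

Lemma Ck_onV V k (U : set V) (F : V -> R) : open U -> (forall x, U x -> F x != 0) ->
  Ck_on k U F -> Ck_on k U (fun x => (F x)^-1).
Proof.
move=> oU F0; elim: k => [|k IH].
  by move=> cF x Ux; apply: continuousV; [exact: F0|exact: cF].
move=> CF'; move: (CF') => [cF dF]; split=> [x Ux|v].
  by apply: continuousV; [exact: F0|exact: cF].
have [dFv CF] := dF v; split=> [x Ux|].
  by apply: derivableV; [exact: F0|exact: dFv].
have IH' := IH (Ck_pred CF').
have C1 := smooth_on_cst (-1 : R) oU k.
apply: Ck_eq_on (Ck_onM oU C1 (Ck_onM oU (Ck_onM oU IH' IH') CF)) => // x Ux.
by rewrite deriveV; [|exact: F0|exact: dFv]; rewrite mulN1r /= -invfM -expr2 scaleNr.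
Qed.

Lemma smooth_onD V W (U : set V) (F G : V -> W) : open U ->
  smooth_on U F -> smooth_on U G -> smooth_on U (fun x => F x + G x).
Proof. by move=> oU sF sG k; exact: Ck_onD. Qed.

Lemma smooth_onM V (U : set V) (F G : V -> R) : open U ->
  smooth_on U F -> smooth_on U G -> smooth_on U (fun x => F x * G x).
Proof. by move=> oU sF sG k; exact: Ck_onM. Qed.

Lemma smooth_onV V (U : set V) (F : V -> R) : open U -> (forall x, U x -> F x != 0) ->
  smooth_on U F -> smooth_on U (fun x => (F x)^-1).
Proof. by move=> oU F0 sF k; exact: Ck_onV. Qed.

Lemma smooth_on_sum V W (U : set V) I (r : seq I) (F : I -> V -> W) : open U ->
  (forall i, smooth_on U (F i)) -> smooth_on U (fun x => \sum_(i <- r) F i x).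
Proof.
move=> oU sF; elim: r => [|i r IH].
  apply: smooth_on_eq (smooth_on_cst (0 : W) oU) => // x _.
  by rewrite big_nil.
apply: smooth_on_eq (smooth_onD oU (sF i) IH) => // x _.
by rewrite big_cons.
Qed.

Lemma continuous_mxP V m n (F : V -> 'M[R]_(m, n)) x :
  (forall i j, {for x, continuous (fun y => F y i j)}) -> {for x, continuous F}.
Proof.
move=> cF; apply/cvgrPdist_lt => e e0; near=> y.
rewrite /Num.Def.normr/= mx_normrE; apply: bigmax_lt => //= i _.
rewrite !mxE /=; move: i; near: y; apply: filter_forall => -[i j].
by have /cvgrPdist_lt/(_ e e0) := cF i j.
Unshelve. all: end_near. Qed.

Lemma smooth_on_mxP V m n (U : set V) (F : V -> 'M[R]_(m, n)) : open U ->
  smooth_on U F <-> forall i j, smooth_on U (fun x => F x i j).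
Proof.
move=> oU; split=> [sF i j k|sF k].
  elim: k F {sF}(sF k) => [|k IH] F; first move=> cF x Ux.
    exact: continuous_comp (cF x Ux) (@coord_continuous _ _ _ _ _ _).
  move=> [cF dF]; split=> [x Ux|v].
    exact: continuous_comp (cF x Ux) (@coord_continuous _ _ _ _ _ _).
  have [dFv CF] := dF v; split=> [x Ux|].
    by have /derivable_mxP := dFv x Ux; exact.
  by apply: Ck_eq_on (IH _ CF) => // x Ux; rewrite derive_mx ?mxE //; exact: dFv.
have {}sF : forall i j, Ck_on k U (fun x => F x i j) by move=> i j; exact: sF.
elim: k F sF => [|k IH] F CF.
  by move=> x Ux; apply: continuous_mxP => i j; exact: CF.
split=> [x Ux|v].
  by apply: continuous_mxP => i j; have [cF _] := CF i j; exact: cF.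
have dF x : U x -> derivable F x v.
  by move=> Ux; apply/derivable_mxP => i j; have [_ /(_ v)[dF _]] := CF i j; exact: dF.
split=> //; apply: IH => i j; have [_ /(_ v)[_ C]] := CF i j.
by apply: Ck_eq_on C => // x Ux; rewrite derive_mx ?mxE //; exact: dF.
Qed.

End CkBasics.

(** * Mean values, first order expansions, symmetry of second derivatives *)

Section MeanValue.
Variable R : realType.
Implicit Types V W : normedModType R.

Lemma is_derive_line V W (F : V -> W) (a v : V) (t : R) : derivable F (a + t *: v) v ->
  is_derive t 1 (fun s : R => F (a + s *: v)) ('D_v F (a + t *: v)).
Proof.
have E : (fun h : R => h^-1 *: (((fun s : R => F (a + s *: v)) \o shift t) (h *: 1) - F (a + t *: v)))
       = (fun h : R => h^-1 *: ((F \o shift (a + t *: v)) (h *: v) - F (a + t *: v))).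
  apply/funext => h /=; congr (_ *: (F _ - _)).
  by rewrite -[h%:A]/(h * 1) mulr1 scalerDl addrCA.
by move=> dF; split; [rewrite /derivable E|rewrite /derive E].
Qed.

Lemma is_derive_cvg V W (f : V -> W) (a v : V) (l : W) :
  (h^-1 *: (f (h *: v + a) - f a) @[h --> (0 : R)^'] --> l) -> is_derive a v f l.
Proof. by move=> fl; split; [apply/cvg_ex; exists l|exact: cvg_lim]. Qed.

(** The mean value theorem between [0] and [c], whatever the sign of [c]: increments along
coordinate axes have no preferred sign. *)
Lemma mean_value_from_0 (f df : R -> R) (c : R) :
  (forall t : R, `|t| <= `|c| -> is_derive t 1 f (df t)) ->
  exists2 t : R, `|t| <= `|c| & f c - f 0 = c * df t.
Proof.
move=> fdf; have [c0|c0] := leP 0 c.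
  have dI x : x \in `[0, c]%R -> is_derive x 1 f (df x).
    by rewrite in_itv => /andP[x0 xc]; apply: fdf; rewrite !ger0_norm // (le_trans x0).
  have dI' x : x \in `]0, c[%R -> is_derive x 1 f (df x) by move=> /subset_itv_oo_cc; exact: dI.
  have cI : {within `[0, c], continuous f} by apply: derivable_within_continuous => x /dI [].
  have [t] := MVT_segment c0 dI' cI.
  rewrite in_itv => /andP[t0 tc] e; exists t; first by rewrite !ger0_norm.
  by rewrite e subr0 mulrC.
have dI x : x \in `[c, 0]%R -> is_derive x 1 f (df x).
  rewrite in_itv => /andP[x0 xc]; apply: fdf; rewrite !ler0_norm ?lerN2 //.
  exact: ltW.
have dI' x : x \in `]c, 0[%R -> is_derive x 1 f (df x) by move=> /subset_itv_oo_cc; exact: dI.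
have cI : {within `[c, 0], continuous f} by apply: derivable_within_continuous => x /dI [].
have [t] := MVT_segment (ltW c0) dI' cI.
rewrite in_itv => /andP[t0 tc] e; exists t; first by rewrite !ler0_norm ?lerN2 // ltW.
by rewrite -opprB e sub0r mulrN opprK mulrC.
Qed.

Lemma mean_value_line V (F : V -> R) (a v : V) (c : R) :
  (forall t : R, `|t| <= `|c| -> derivable F (a + t *: v) v) ->
  exists2 t : R, `|t| <= `|c| & F (a + c *: v) - F a = c * 'D_v F (a + t *: v).
Proof.
move=> dF; have [t tc e] := @mean_value_from_0 (fun s => F (a + s *: v)) (fun t => 'D_v F (a + t *: v)) c
  (fun t tc => is_derive_line (dF t tc)).
by exists t => //; rewrite -e scale0r addr0.
Qed.

Lemma open_ball_sub V (U : set V) x : open U -> U x ->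
  exists2 d : R, 0 < d & forall y, `|y - x| < d -> U y.
Proof.
move=> oU Ux; have /nbhs_ballP[d /= d0 h] : nbhs x U by exact: open_nbhs_nbhs.
by exists d => // y yx; apply: h; rewrite -ball_normE /= distrC.
Qed.

Lemma continuous_dist V W (F : V -> W) x e : {for x, continuous F} -> 0 < e ->
  exists2 d : R, 0 < d & forall y, `|y - x| < d -> `|F y - F x| <= e.
Proof.
move=> /cvgrPdist_le/(_ e)/[apply] /nbhs_ballP[d /= d0 h]; exists d => // y yx.
by rewrite distrC; apply: h; rewrite -ball_normE /= distrC.
Qed.

Lemma common_radius V (I : finType) (P : I -> V -> Prop) (x : V) :
  (forall i, exists2 d : R, 0 < d & forall y, `|y - x| < d -> P i y) ->
  exists2 d : R, 0 < d & forall y, `|y - x| < d -> forall i, P i y.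
Proof.
move=> h; have : nbhs x [set y | forall i, P i y].
  apply: (filter_forall (f := P)) => i; have [d d0 dP] := h i.
  by apply/nbhs_ballP; exists d => // y; rewrite -ball_normE /= distrC; exact: dP.
move=> /nbhs_ballP[d /= d0 dP]; exists d => // y yx; apply: dP.
by rewrite -ball_normE /= distrC.
Qed.

(** Two applications of the mean value theorem, first along [v] to the increment in
direction [w], then along [w]. *)
Lemma second_difference V (U : set V) (F : V -> R) x v w (s t : R) : Ck_on 2 U F ->
  (forall s' t' : R, `|s'| <= `|s| -> `|t'| <= `|t| -> U (x + s' *: v + t' *: w)) ->
  exists s' t' : R, [/\ `|s'| <= `|s|, `|t'| <= `|t| &
    F (x + s *: v + t *: w) - F (x + s *: v) - (F (x + t *: w) - F x) =
    s * (t * 'D_w ('D_v F) (x + s' *: v + t' *: w))].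
Proof.
move=> [_ dF] inU; have [dv [_ /(_ w)[dvw _]]] := dF v.
have U0 (s' : R) : `|s'| <= `|s| -> U (x + s' *: v).
  by move=> h; have := inU s' 0 h; rewrite scale0r addr0; apply; rewrite normr0.
pose f (s' : R) := F (x + t *: w + s' *: v) - F (x + s' *: v).
pose df (s' : R) := 'D_v F (x + t *: w + s' *: v) - 'D_v F (x + s' *: v).
have fdf (s' : R) : `|s'| <= `|s| -> is_derive s' 1 f (df s').
  move=> s's; have h1 := is_derive_line (dv _ (U0 _ s's)).
  have U1 : U (x + t *: w + s' *: v) by rewrite addrAC; exact: inU.
  have h2 := is_derive_line (dv _ U1).
  exact: is_deriveB.
have [s' s's e] := mean_value_from_0 fdf.
have [t' t't e'] := @mean_value_line _ ('D_v F) (x + s' *: v) w t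
  (fun t' t't => dvw _ (inU s' t' s's t't)).
exists s', t'; split=> //.
by rewrite -e' (addrAC x (s' *: v)) -e /f !scale0r !addr0 (addrAC x (s *: v)).
Qed.

(** Both mixed derivatives are limits of the same second difference quotient. *)
Lemma derive_comm V (U : set V) (F : V -> R) x v w : open U -> U x -> smooth_on U F ->
  'D_v ('D_w F) x = 'D_w ('D_v F) x.
Proof.
move=> oU Ux sF; apply/eqP; rewrite -subr_eq0 -normr_le0; apply/ler_addgt0Pr => e e0.
rewrite add0r.
have cvw := smooth_on_continuous (smooth_on_derive v (smooth_on_derive w sF)) Ux.
have cwv := smooth_on_continuous (smooth_on_derive w (smooth_on_derive v sF)) Ux.
have e20 : 0 < e / 2 by rewrite divr_gt0.
have [d1 d10 h1] := continuous_dist cvw e20.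
have [d2 d20 h2] := continuous_dist cwv e20.
have [d3 d30 h3] := open_ball_sub oU Ux.
pose d := Num.min d1 (Num.min d2 d3).
have d0 : 0 < d by rewrite !lt_min d10 d20.
(* so small that the parallelogram with sides [h *: v] and [h *: w] stays in the ball *)
pose h := d / 2 / (`|v| + `|w| + 1).
have vw0 : 0 < `|v| + `|w| + 1 by rewrite ltr_wpDl // addr_ge0.
have h0 : 0 < h by rewrite !divr_gt0.
have small (s t : R) v' w' : `|v'| + `|w'| = `|v| + `|w| -> `|s| <= `|h| -> `|t| <= `|h| ->
    `|x + s *: v' + t *: w' - x| < d.
  move=> e' sh th; rewrite addrAC [x + _]addrC addrK.
  apply: le_lt_trans (ler_normD _ _) _; rewrite !normrZ.
  have : `|s| * `|v'| + `|t| * `|w'| <= h * (`|v| + `|w| + 1).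
    rewrite -e' mulrDr mulr1 ler_wpDr ?(ltW h0) // mulrDr.
    by rewrite lerD // ler_wpM2r // -(ger0_norm (ltW h0)).
  move=> /le_lt_trans; apply; rewrite /h divfK ?gt_eqF //.
  by rewrite ltr_pdivrMr // ltr_pMr // ltr1n.
have d_d3 : d <= d3 by rewrite !ge_min lexx !orbT.
have [s [t [hs ht e1]]] := second_difference (sF 2%N)
  (fun s t hs ht => h3 _ (lt_le_trans (small s t v w erefl hs ht) d_d3)).
have [s' [t' [hs' ht' e2]]] := second_difference (sF 2%N)
  (fun s t hs ht => h3 _ (lt_le_trans (small s t w v (addrC _ _) hs ht) d_d3)).
have : 'D_w ('D_v F) (x + s *: v + t *: w) = 'D_v ('D_w F) (x + s' *: w + t' *: v).
  have hn0 : h != 0 by rewrite gt_eqF.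
  apply: (mulfI hn0); apply: (mulfI hn0).
  apply: etrans (esym e1) _; apply: etrans _ e2; rewrite (addrAC x (h *: w)).
  move: (F (x + h *: v + h *: w)) (F (x + h *: v)) (F (x + h *: w)) (F x) => a b c a'.
  by ring.
have b1 : `|'D_w ('D_v F) (x + s *: v + t *: w) - 'D_w ('D_v F) x| <= e / 2.
  apply: h2; apply: lt_le_trans (small _ _ _ _ erefl hs ht) _.
  by rewrite !ge_min lexx !orbT.
have b2 : `|'D_v ('D_w F) (x + s' *: w + t' *: v) - 'D_v ('D_w F) x| <= e / 2.
  apply: h1; apply: lt_le_trans (small _ _ _ _ (addrC _ _) hs' ht') _.
  by rewrite !ge_min lexx.
move: b1 b2; move: ('D_w ('D_v F) (x + _ + _)) ('D_v ('D_w F) (x + _ + _)) ('D_w ('D_v F) x)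
  ('D_v ('D_w F) x) => a b c a' b1 b2 ab.
rewrite [e]splitr -(subrKA b) (le_trans (ler_normD _ _)) //.
by rewrite ab in b1; rewrite lerD // distrC.
Qed.

End MeanValue.

Section Taylor.
Variables (R : realType) (n : nat).
Implicit Types (F : 'rV[R]_n -> R) (U : set 'rV[R]_n).

Lemma norm_coord_le (x : 'rV[R]_n) i : `|x 0 i| <= `|x|.
Proof. by rewrite [leRHS]/Num.Def.normr /= mx_normrE; apply: (le_bigmax _ _ (0, i)). Qed.

Lemma norm_row_le (x : 'rV[R]_n) e : 0 <= e -> (forall i, `|x 0 i| <= e) -> `|x| <= e.
Proof.
move=> e0 h; rewrite [leLHS]/Num.Def.normr /= mx_normrE; apply: bigmax_le => // -[i j] _.
by rewrite ord1.
Qed.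

(** Moving from [x] to [y] one coordinate at a time, the mean value theorem and the
continuity of the partial derivatives bound the error of each step. *)
Lemma first_order_expansion U F x e : open U -> U x -> smooth_on U F -> 0 < e ->
  exists2 d : R, 0 < d & forall y, `|y - x| < d ->
    `|F y - F x - \sum_i (y - x) 0 i * partial i F x| <= e * `|y - x|.
Proof.
move=> oU Ux sF e0; (* an [e]-share for each coordinate, with [n.+1] so that [n = 0] needs no case *)
pose e' := e / n.+1%:R.
have e'0 : 0 < e' by rewrite divr_gt0.
have [d1 d10 h1] := open_ball_sub oU Ux.
have [d2 d20 h2] : exists2 d2 : R, 0 < d2 & forall y, `|y - x| < d2 -> forall i,
    `|partial i F y - partial i F x| <= e'.
  apply: common_radius => i.
  exact: (continuous_dist (smooth_on_continuous (smooth_on_derive (delta_mx 0 i) sF) Ux) e'0).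
exists (Num.min d1 d2); first by rewrite lt_min d10.
move=> y; rewrite lt_min => /andP[yx1 yx2].
(* [z r] has moved from [x] to [y] in the coordinates listed in [r] *)
pose z (r : seq 'I_n) : 'rV[R]_n := \row_j if j \in r then y 0 j else x 0 j.
have main (r : seq 'I_n) : uniq r ->
    `|F (z r) - F x - \sum_(i <- r) (y - x) 0 i * partial i F x| <= (size r)%:R * e' * `|y - x|.
  elim: r => [|i r IH] /=.
    have -> : z [::] = x by apply/rowP => j; rewrite mxE.
    by rewrite big_nil subrr subr0 normr0 !mul0r.
  move=> /andP[ir ur].
  have zE : z (i :: r) = z r + (y - x) 0 i *: delta_mx 0 i.
    apply/rowP => j; rewrite !mxE inE eqxx /=.
    case: eqVneq => [->|_] /=; last by rewrite mulr0 addr0.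
    by rewrite (negbTE ir) mulr1 addrC subrK.
  have near_x (t : R) : `|t| <= `|(y - x) 0 i| -> `|z r + t *: delta_mx 0 i - x| <= `|y - x|.
    move=> ht; apply: norm_row_le => // j; rewrite !mxE eqxx /=.
    case: eqVneq => [->|_] /=.
      rewrite (negbTE ir) mulr1 addrAC subrr add0r.
      exact: le_trans ht (norm_coord_le _ _).
    rewrite mulr0 addr0; case: ifP => _; last by rewrite subrr normr0.
    by have := norm_coord_le (y - x) j; rewrite !mxE.
  have [|t ht Et] := @mean_value_line R _ F (z r) (delta_mx 0 i) ((y - x) 0 i).
    move=> t ht; have Uz := h1 _ (le_lt_trans (near_x t ht) yx1).
    exact: smooth_on_derivable sF Uz.
  rewrite big_cons zE.
  have -> : F (z r + (y - x) 0 i *: delta_mx 0 i) - F x -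
      ((y - x) 0 i * partial i F x + \sum_(j <- r) (y - x) 0 j * partial j F x) =
      (y - x) 0 i * (partial i F (z r + t *: delta_mx 0 i) - partial i F x) +
      (F (z r) - F x - \sum_(j <- r) (y - x) 0 j * partial j F x).
    by rewrite -[F (z r + _)](subrK (F (z r))) Et /partial; ring.
  apply: le_trans (ler_normD _ _) _.
  rewrite -[(size r).+1]add1n natrD !mulrDl mul1r lerD //; last exact: IH.
  rewrite normrM mulrC; apply: ler_pM => //; last exact: norm_coord_le.
  by apply: h2; exact: le_lt_trans (near_x t ht) yx2.
have := main (enum 'I_n) (enum_uniq _); rewrite size_enum_ord big_enum /=.
have -> : z (enum 'I_n) = y by apply/rowP => j; rewrite mxE mem_enum.
move=> /le_trans; apply; apply: ler_wpM2r => //.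
by rewrite /e' mulrCA ger_pMr // ler_pdivrMr // mul1r ler_nat.
Qed.

(** Linearity of the derivative in its direction, which the definition by directional
limits does not provide, read off the first order expansion. *)
Lemma derive_partials U F x v : open U -> U x -> smooth_on U F ->
  'D_v F x = \sum_i v 0 i * partial i F x.
Proof.
move=> oU Ux sF; apply/cvg_lim => //; apply/cvgrPdist_le => e e0.
have v10 : 0 < `|v| + 1 by rewrite ltr_wpDl.
have [d d0 h] := first_order_expansion oU Ux sF (divr_gt0 e0 v10).
near=> t.
have t0 : t != 0 by near: t; exact: nbhs_dnbhs_neq.
have td : `|t *: v + x - x| < d.
  rewrite addrK normrZ; have : `|t| < d / (`|v| + 1) by near: t; apply: dnbhs0_lt; rewrite divr_gt0.
  rewrite ltr_pdivlMr // => /(le_lt_trans _); apply.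
  by rewrite ler_wpM2l // lerDl.
have := h _ td; rewrite addrK => {}h.
have -> : \sum_i v 0 i * partial i F x = t^-1 * \sum_i (t *: v) 0 i * partial i F x.
  rewrite mulr_sumr; apply: eq_bigr => i _; rewrite mxE !mulrA mulVf // mul1r //.
rewrite distrC -[_ *: _]/(_ * _) -mulrBr normrM normfV ler_pdivrMl ?normr_gt0 //.
apply: le_trans h _; rewrite normrZ mulrCA ler_wpM2l //.
by rewrite mulrAC ler_pdivrMr // ler_wpM2l ?(ltW e0) // lerDl.
Unshelve. all: end_near. Qed.

End Taylor.

(** * Polynomials as smooth functions *)

Section PolynomialCalculus.
Variables (R : realType) (n : nat).
Implicit Types (p q : mpoly n R).

Lemma mpoly_ind_ring (P : mpoly n R -> Prop) :
  (forall c, P (mpolyC n c)) -> (forall i, P (mpolyX R (mnm1 i))) ->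
  (forall p q, P p -> P q -> P (p + q)) -> (forall p q, P p -> P q -> P (p * q)) ->
  forall p, P p.
Proof.
move=> PC PX PD PM p; elim/mpolyind: p => [|c m p _ _ Pp]; first by rewrite -mpolyC0.
apply: PD => //; rewrite -mul_mpolyC; apply: (PM) => //; rewrite mpolyXE_id.
elim/big_ind: _ => [|a b Pa Pb|i _]; [by rewrite -mpolyC1|exact: PM|].
by elim: (m i) => [|k IH]; rewrite ?expr0 -?mpolyC1 // exprS; exact: PM.
Qed.

(** The chain rule for polynomials, from the sum and product rules by induction on their
construction. *)
Lemma is_derive_meval_comp (V : normedModType R) (z : V -> 'rV[R]_n) (x v : V) (dz : 'I_n -> R) p :
  (forall j, is_derive x v (fun y => z y 0 j) (dz j)) ->
  is_derive x v (fun y => meval (z y 0) p) (\sum_j dz j * meval (z x 0) (mderiv j p)).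
Proof.
move=> zdz; elim/mpoly_ind_ring: p => [c|i|p q IHp IHq|p q IHp IHq].
- have -> : (fun y => meval (z y 0) (mpolyC n c)) = cst c.
    by apply/funext => y; rewrite mevalC.
  rewrite [X in is_derive _ _ _ X](_ : _ = 0); first exact: is_derive_cst.
  by rewrite big1 // => i _; rewrite mderivC meval0 mulr0.
- have -> : (fun y => meval (z y 0) (mpolyX R (mnm1 i))) = (fun y => z y 0 i).
    by apply/funext => y; rewrite mevalXU.
  rewrite (bigD1 i) //= big1 ?addr0 => [|j ji]; last first.
    by rewrite mderivX mnm1E eq_sym (negbTE ji) scale0r meval0 mulr0.
  have e : mnm_sub (mnm1 i) (mnm1 i) = mnm0 by apply/mnmP => k; rewrite mnmBE mnm0E subnn.
  by rewrite mderivX mnm1E eqxx scale1r e mpolyX0 meval1 mulr1; exact: zdz.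
- have -> : (fun y => meval (z y 0) (p + q)) =
            (fun y => meval (z y 0) p) + (fun y => meval (z y 0) q).
    by apply/funext => y; rewrite mevalD.
  rewrite [X in is_derive _ _ _ X](_ : _ = \sum_i dz i * meval (z x 0) (mderiv i p) +
     \sum_i dz i * meval (z x 0) (mderiv i q)); first exact: is_deriveD.
  by rewrite -big_split; apply: eq_bigr => i _; rewrite mderivD mevalD mulrDr.
- have -> : (fun y => meval (z y 0) (p * q)) =
            (fun y => meval (z y 0) p) * (fun y => meval (z y 0) q).
    by apply/funext => y; rewrite mevalM.
  rewrite [X in is_derive _ _ _ X](_ : _ = meval (z x 0) p *: \sum_i dz i * meval (z x 0) (mderiv i q) +
     meval (z x 0) q *: \sum_i dz i * meval (z x 0) (mderiv i p)); first exact: is_deriveM.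
  rewrite !scaler_sumr -big_split; apply: eq_bigr => i _ /=.
  by rewrite mderivM mevalD !mevalM -![_ *: _]/(_ * _); ring.
Qed.

Lemma is_derive_meval p (x v : 'rV[R]_n) :
  is_derive x v (fun y => meval (y 0) p) (\sum_i v 0 i * meval (x 0) (mderiv i p)).
Proof.
apply: (is_derive_meval_comp (z := id) (dz := fun i => v 0 i)) => i.
have d : derivable (@id 'rV[R]_n) x v by exact: derivable_id.
split; first by move/derivable_mxP: d => /(_ 0 i).
have := derive_mx d; rewrite derive_id => /(congr1 (fun M : 'rV[R]_n => M 0 i)).
by rewrite mxE => <-.
Qed.

Lemma partial_meval p (x : 'rV[R]_n) j :
  partial j (fun y => meval (y 0) p) x = meval (x 0) (mderiv j p).
Proof.
rewrite /partial; have [_ ->] := is_derive_meval p x (delta_mx 0 j).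
rewrite (bigD1 j) //= mxE !eqxx mul1r big1 ?addr0 // => i ij.
by rewrite mxE (negbTE ij) andbF mul0r.
Qed.

Lemma Ck_on_meval_comp (V : normedModType R) k (U : set V) (z : V -> 'rV[R]_n) p : open U ->
  (forall j, Ck_on k U (fun y => z y 0 j)) -> Ck_on k U (fun y => meval (z y 0) p).
Proof.
move=> oU Cz; elim/mpoly_ind_ring: p => [c|i|p q IHp IHq|p q IHp IHq].
- by apply: Ck_eq_on (smooth_on_cst c oU k) => // x _; rewrite mevalC.
- by apply: Ck_eq_on (Cz i) => // x _; rewrite mevalXU.
- by apply: Ck_eq_on (Ck_onD oU IHp IHq) => // x _; rewrite mevalD.
- by apply: Ck_eq_on (Ck_onM oU IHp IHq) => // x _; rewrite mevalM.
Qed.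

Lemma continuous_meval p : continuous (fun y : 'rV[R]_n => meval (y 0) p).
Proof.
elim/mpoly_ind_ring: p => [c|i|p q IHp IHq|p q IHp IHq] x.
- have -> : (fun y : 'rV[R]_n => meval (y 0) (mpolyC n c)) = cst c.
    by apply/funext => y; rewrite mevalC.
  exact: cst_continuous.
- have -> : (fun y : 'rV[R]_n => meval (y 0) (mpolyX R (mnm1 i))) = (fun y => y 0 i).
    by apply/funext => y; rewrite mevalXU.
  exact: coord_continuous.
- have -> : (fun y : 'rV[R]_n => meval (y 0) (p + q)) =
            (fun y => meval (y 0) p + meval (y 0) q).
    by apply/funext => y; rewrite mevalD.
  by apply: continuousD; [exact: IHp|exact: IHq].
- have -> : (fun y : 'rV[R]_n => meval (y 0) (p * q)) =
            (fun y => meval (y 0) p * meval (y 0) q).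
    by apply/funext => y; rewrite mevalM.
  by apply: continuousM; [exact: IHp|exact: IHq].
Qed.

Lemma smooth_on_meval U p : open U -> smooth_on U (fun x : 'rV[R]_n => meval (x 0) p).
Proof.
move=> oU; pose E : set ('rV[R]_n -> R) := [set F | exists p, F = fun x : 'rV[R]_n => meval (x 0) p].
apply: (@smooth_on_class R 'rV[R]_n R U E oU).
- by move=> F x [q ->] _; exact: continuous_meval.
- by move=> F x v [q ->] _; have [] := is_derive_meval q x v.
- move=> F v [q ->]; exists (fun x : 'rV[R]_n => meval (x 0) (\sum_i v 0 i *: mderiv i q)).
    by exists (\sum_i v 0 i *: mderiv i q).
  move=> x _; have [_ ->] := is_derive_meval q x v.
  by rewrite raddf_sum; apply: eq_bigr => i _ /=; rewrite mevalZ.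
- by exists p.
Qed.

End PolynomialCalculus.

(** * A smooth curve of fixed points *)

(** A polynomial map [Psi] of [(t, u)] without constant and linear part has derivatives
smaller than [1/2] near the origin.  Hence it is a contraction in [u] for each small
[t], and its fixed points [u t] form a curve.  The curve is Lipschitz because [Psi] also
contracts in [t]; differentiating [u = Psi (t, u)] then gives
[u' (1 - B (t, u)) = A (t, u)] with polynomial [A] and [B], so [u'] is a rational function
of [(t, u)] and [u] is smooth by induction on the order.  This is the part of the
implicit function theorem used to produce curves in a variety. *)

Section PolynomialFixedPoint.
Variable R : realType.

(** A point minimising the displacement [`|u - f u|] on the compact ball is fixed, since
[f] moves its image at most half as far. *)
Lemma half_contraction_fixed_point c (f : 'rV[R]_c -> 'rV[R]_c) (r : R) : 0 <= r ->
  continuous f -> (forall u, `|u| <= r -> `|f u| <= r) ->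
  (forall u v, `|u| <= r -> `|v| <= r -> `|f u - f v| <= 2^-1 * `|u - v|) ->
  exists2 u, `|u| <= r & u = f u.
Proof.
move=> r0 cf fr fL; pose A := [set u : 'rV[R]_c | `|u| <= r].
have cA : compact A.
  apply: bounded_closed_compact.
    exists r; split; first exact: num_real.
    by move=> M rM u ur; apply: le_trans ur (ltW rM).
  have -> : A = closed_ball_ Num.norm 0 r.
    by apply/seteqP; split=> u; rewrite /closed_ball_ /= sub0r normrN.
  exact: closed_closed_ball_.
have A0 : A !=set0 by exists 0; rewrite /A /= normr0.
have cg : continuous (fun u : 'rV[R]_c => `|u - f u|).
  move=> u; apply: (@continuous_comp _ _ _ (fun u : 'rV[R]_c => u - f u) Num.norm); last exact: norm_continuous.
  by apply: continuousB; [exact: id|exact: cf].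
have [u uA umin] := EVT_min_rV A0 cA (continuous_subspaceT cg).
rewrite inE in uA; exists u => //; apply/eqP; rewrite -subr_eq0 -normr_le0.
have fuA : f u \in A by rewrite inE; exact: fr.
have := le_trans (umin _ fuA) (fL _ _ uA (fr _ uA)).
have := normr_ge0 (u - f u); lra.
Qed.

Variables (c : nat) (q : 'I_c -> mpoly (1 + c) R).
Local Notation N := (1 + c)%N.
Hypothesis q0 : forall i, meval ((0 : 'rV[R]_N) 0) (q i) = 0.
Hypothesis dq0 : forall i j, meval ((0 : 'rV[R]_N) 0) (mderiv j (q i)) = 0.

Let Psi (z : 'rV[R]_N) : 'rV[R]_c := \row_i meval (z 0) (q i).
Let pt (t : R) (u : 'rV[R]_c) : 'rV[R]_N := row_mx (const_mx t) u.

Let pt_le (t : R) u (e : R) : `|t| <= e -> `|u| <= e -> `|pt t u| <= e.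
Proof.
move=> te ue; apply: norm_row_le => [|i]; first exact: le_trans te.
rewrite /pt; case: (split_ordP i) => j ->; rewrite ?row_mxEl ?row_mxEr ?mxE //.
exact: le_trans (norm_coord_le _ _) ue.
Qed.

Let pt_sub t u s v : pt t u - pt s v = pt (t - s) (u - v).
Proof. by rewrite /pt opp_row_mx add_row_mx; congr row_mx; apply/rowP => i; rewrite !mxE. Qed.

(* The radius is tripled because the mean value theorem is applied at points
   [z' + t (z - z')] with [t] between [-1] and [1]. *)
Let small_derivatives : exists2 r : R, 0 < r & forall z : 'rV[R]_N, `|z| <= 3 * r ->
  forall i, \sum_j `|meval (z 0) (mderiv j (q i))| <= 2^-1.
Proof.
have e0 : 0 < (2 * N%:R)^-1 :> R by rewrite invr_gt0 mulr_gt0 // ltr0n.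
have : nbhs (0 : 'rV[R]_N) [set z : 'rV[R]_N | forall ij : 'I_c * 'I_N,
    `|meval (z 0) (mderiv ij.2 (q ij.1))| <= (2 * N%:R)^-1].
  apply: (@filter_forall _ _ (fun (ij : 'I_c * 'I_N) (z : 'rV[R]_N) =>
    `|meval (z 0) (mderiv ij.2 (q ij.1))| <= (2 * N%:R)^-1) (nbhs (0 : 'rV[R]_N))) => -[i j] /=.
  have /cvgrPdist_le/(_ _ e0) := @continuous_meval R N (mderiv j (q i)) 0.
  by apply: filterS => z; rewrite dq0 sub0r normrN.
move=> /nbhs_ballP[d /= d0 dP]; exists (d / 4); first by rewrite divr_gt0.
move=> z zd i; apply: (@le_trans _ _ (\sum_(j < N) (2 * N%:R)^-1)).
  apply: ler_sum => j _; apply: (dP z _ (i, j)).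
  rewrite -ball_normE /= sub0r normrN; apply: le_lt_trans zd _.
  by rewrite mulrCA gtr_pMr // ltr_pdivrMr // mul1r ltr_nat.
by rewrite sumr_const card_ord -[leLHS]mulr_natr invfM -mulrA mulVf ?mulr1 // pnatr_eq0.
Qed.

Let r := projT1 (cid2 small_derivatives).
Let r_gt0 : 0 < r.
Proof. by rewrite /r; case: cid2. Qed.
Let rP (z : 'rV[R]_N) : `|z| <= 3 * r -> forall i, \sum_j `|meval (z 0) (mderiv j (q i))| <= 2^-1.
Proof. by rewrite /r; case: cid2 => /= x _ h; exact: h. Qed.

Let dq_bound (z v : 'rV[R]_N) i : `|z| <= 3 * r ->
  `|\sum_j v 0 j * meval (z 0) (mderiv j (q i))| <= 2^-1 * `|v|.
Proof.
move=> /rP/(_ i) h; apply: le_trans (ler_norm_sum _ _ _) _.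
rewrite mulrC; apply: le_trans (ler_wpM2l (normr_ge0 v) h); rewrite mulr_sumr.
by apply: ler_sum => j _; rewrite normrM ler_wpM2r // norm_coord_le.
Qed.

Let Psi_lipschitz z z' : `|z| <= r -> `|z'| <= r -> `|Psi z - Psi z'| <= 2^-1 * `|z - z'|.
Proof.
move=> zr zr'; apply: norm_row_le => [|i]; first by rewrite mulr_ge0.
rewrite !mxE.
have [t _|t t1] := @mean_value_line R _ (fun z : 'rV[R]_N => meval (z 0) (q i)) z' (z - z') 1.
  by have [] := is_derive_meval (q i) (z' + t *: (z - z')) (z - z').
rewrite scale1r mul1r (addrC z') subrK => ->.
have [_ ->] := is_derive_meval (q i) (z' + t *: (z - z')) (z - z').
apply: dq_bound; apply: le_trans (ler_normD _ _) _; rewrite normrZ.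
have h1 : `|z - z'| <= 2 * r by rewrite (le_trans (ler_normB _ _)) // mulr_natl mulr2n lerD.
have h2 : `|t| * `|z - z'| <= 1 * (2 * r).
  by apply: ler_pM => //; rewrite normr1 in t1.
by rewrite -[3]/(1 + 2) mulrDl mul1r lerD // -[2 * r]mul1r.
Qed.

Let Psi0 : Psi 0 = 0.
Proof. by apply/rowP => i; rewrite !mxE q0. Qed.

Let fixed (t : R) : exists u, `|t| <= r -> `|u| <= r /\ u = Psi (pt t u).
Proof.
case: (leP `|t| r) => [tr|_]; last by exists 0.
have [||u v ur vr|u ur uE] := @half_contraction_fixed_point c (fun u => Psi (pt t u)) r (ltW r_gt0).
- move=> u; apply: continuous_mxP => i j; rewrite ord1.
  have -> : (fun u => Psi (pt t u) 0 j) = (fun u => meval (pt t u 0) (q j)).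
    by apply/funext => v; rewrite mxE.
  apply: (@continuous_comp _ _ _ (pt t) (fun z : 'rV[R]_N => meval (z 0) (q j))); last exact: continuous_meval.
  apply: continuous_mxP => i' k; rewrite ord1 /pt; case: (split_ordP k) => l ->.
    have -> : (fun y : 'rV[R]_c => row_mx (const_mx t : 'rV_1) y 0 (lshift c l)) = cst t.
      by apply/funext => y; rewrite row_mxEl mxE.
    exact: cst_continuous.
  have -> : (fun y : 'rV[R]_c => row_mx (const_mx t : 'rV_1) y 0 (rshift 1 l)) = (fun y => y 0 l).
    by apply/funext => y; rewrite row_mxEr.
  exact: coord_continuous.
- move=> u ur; have := Psi_lipschitz (pt_le tr ur) (ltac:(by rewrite normr0 ltW) : `|0 : 'rV[R]_N| <= r).
  rewrite Psi0 !subr0 => /le_trans; apply.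
  by rewrite ler_pdivrMl // mulr_natl mulr2n ler_wpDr ?pt_le // ltW.
- apply: le_trans (Psi_lipschitz (pt_le tr ur) (pt_le tr vr)) _.
  by rewrite pt_sub subrr ler_pM2l ?invr_gt0 //; apply: pt_le; rewrite ?normr0.
by exists u.
Qed.

Let u := projT1 (choice fixed).
Let u_r t : `|t| <= r -> `|u t| <= r.
Proof. by rewrite /u; case: choice => /= f h /h[]. Qed.
Let u_fix t : `|t| <= r -> u t = Psi (pt t (u t)).
Proof. by rewrite /u; case: choice => /= f h /h[]. Qed.

(* Otherwise the distance of the [u]-parts dominates, and it would be at most half of
   itself. *)
Let u_lip s t : `|s| <= r -> `|t| <= r -> `|u t - u s| <= `|t - s|.
Proof.
move=> sr tr; rewrite leNgt; apply/negP => lt.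
have : `|u t - u s| <= 2^-1 * `|u t - u s|.
  rewrite {1}(u_fix sr) {1}(u_fix tr).
  apply: le_trans (Psi_lipschitz (pt_le tr (u_r tr)) (pt_le sr (u_r sr))) _.
  by rewrite pt_sub ler_pM2l ?invr_gt0 //; apply: pt_le => //; exact: ltW.
have := normr_ge0 (t - s); lra.
Qed.

Let z t := pt t (u t).
Let U := [set t : R | `|t| < r].

(* The polynomial matrices [1 - B] and [A] of the differentiated fixed point equation. *)
Let E : 'M[mpoly N R]_c := \matrix_(i, j) ((i == j)%:R - mderiv (rshift 1 i) (q j)).
Let A : 'rV[mpoly N R]_c := \row_i mderiv (lshift c ord0) (q i).

Let ev (x : 'rV[R]_N) : {rmorphism mpoly N R -> R} := meval (x 0).

Let mulmxE x (v : 'rV[R]_c) i : (v *m map_mx (ev x) E) 0 i =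
  v 0 i - \sum_j v 0 j * meval (x 0) (mderiv (rshift 1 j) (q i)).
Proof.
rewrite mxE; under eq_bigr => j _ do rewrite !mxE rmorphB rmorph_nat mulrBr.
rewrite sumrB (bigD1 i) //= eqxx mulr1 big1 ?addr0 // => j ji.
by rewrite (negbTE ji) mulr0.
Qed.

(* A row vector killed by [1 - B] is at most half as long as itself. *)
Let det_unit (x : 'rV[R]_N) : `|x| <= r -> \det (map_mx (ev x) E) != 0.
Proof.
move=> xr; rewrite -unitfE -unitmxE -row_free_unit -kermx_eq0.
apply/rowV0P => v; rewrite sub_kermx => /eqP vE.
have {}vE i : v 0 i = \sum_j (pt 0 v) 0 j * meval (x 0) (mderiv j (q i)).
  move/rowP/(_ i): vE; rewrite mulmxE mxE => /eqP; rewrite subr_eq0 => /eqP ->.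
  rewrite big_split_ord /= big_ord1 /pt row_mxEl mxE mul0r add0r.
  by apply: eq_bigr => j _; rewrite row_mxEr.
have xr3 : `|x| <= 3 * r by apply: le_trans xr _; rewrite ler_pMl ?ler1n.
have : `|v| <= 2^-1 * `|v|.
  apply: norm_row_le => [|i]; first by rewrite mulr_ge0.
  rewrite vE; apply: le_trans (dq_bound _ _ xr3) _.
  by rewrite ler_pM2l ?invr_gt0 //; apply: pt_le; rewrite ?normr0.
by move=> h; apply/eqP; rewrite -normr_le0; have := normr_ge0 v; lra.
Qed.

Let z_r (s : R) : `|s| <= r -> `|z s| <= r.
Proof. by move=> sr; apply: pt_le => //; exact: u_r. Qed.

Let is_derive_u (s : R) k : `|s| < r ->
  is_derive s 1 (fun t : R => u t 0 k) (ev (z s) ((A *m \adj E) 0 k) / ev (z s) (\det E)).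
Proof.
move=> sr; have sr' := ltW sr; set x := z s.
pose A' := map_mx (ev x) A; pose E' := map_mx (ev x) E; pose V' := invmx E'.
have E'unit : E' \in unitmx by rewrite unitmxE unitfE; exact: det_unit (z_r sr').
have -> : ev x ((A *m \adj E) 0 k) / ev x (\det E) = (A' *m V') 0 k.
  rewrite /V' /invmx E'unit -map_mx_adj -scalemxAr [RHS]mxE -map_mxM -det_map_mx.
  have e : map_mx (ev x) (A *m \adj E) 0 k = ev x ((A *m \adj E) 0 k) by rewrite [LHS]mxE.
  by rewrite e mulrC.
apply: is_derive_cvg; apply/cvgrPdist_le => e e0.
pose S := 1 + \sum_i `|V' i k|.
have S0 : 0 < S by rewrite ltr_pwDl // sumr_ge0.
have eS0 : 0 < e / S by rewrite divr_gt0.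
have [d d0 dP] : exists2 d : R, 0 < d & forall y, `|y - x| < d -> forall i,
    `|meval (y 0) (q i) - meval (x 0) (q i) - \sum_j (y - x) 0 j * meval (x 0) (mderiv j (q i))|
      <= e / S * `|y - x|.
  apply: common_radius => i.
  have [d d0 dP] := first_order_expansion openT I (smooth_on_meval (q i) openT) eS0 (x := x).
  exists d => // y /dP; congr (_ <= _); congr (`|_ - _|).
  by apply: eq_bigr => j _; rewrite partial_meval.
near=> t.
have t0 : t != 0 by near: t; exact: nbhs_dnbhs_neq.
have td : `|t| < d by near: t; exact: dnbhs0_lt.
have ts : `|t| < r - `|s| by near: t; apply: dnbhs0_lt; rewrite subr_gt0.
rewrite -[t%:A]/(t * 1) mulr1.
have tsr : `|t + s| <= r.
  by apply: le_trans (ler_normD _ _) _; rewrite -lerBrDr ltW.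
pose D := u (t + s) - u s.
have Dt : `|D| <= `|t| by have := u_lip sr' tsr; rewrite addrK.
have yx : z (t + s) - x = pt t D by rewrite /x /z pt_sub addrK.
have yxt : `|z (t + s) - x| <= `|t| by rewrite yx; exact: pt_le.
have {}dP := dP _ (le_lt_trans yxt td).
pose rho := D *m E' - t *: A'.
have rhoP i : `|rho 0 i| <= e / S * `|t|.
  apply: le_trans (ler_wpM2l (ltW eS0) yxt); apply: le_trans (dP i); rewrite yx.
  rewrite le_eqVlt; apply/orP; left; apply/eqP; congr (`|_|).
  have -> : rho 0 i = (D *m E') 0 i - t * A' 0 i by rewrite /rho !mxE.
  rewrite mulmxE big_split_ord /= big_ord1 /pt row_mxEl [const_mx t 0 0]mxE.
  have -> : D 0 i = meval (z (t + s) 0) (q i) - meval (x 0) (q i).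
    by rewrite /D {1}(u_fix tsr) {1}(u_fix sr') !mxE.
  have -> : A' 0 i = meval (x 0) (mderiv (lshift c ord0) (q i)) by rewrite !mxE.
  under [in RHS]eq_bigr => j _ do rewrite row_mxEr.
  by rewrite opprD addrA addrAC.
have -> : u (t + s) 0 k - u s 0 k = D 0 k by rewrite !mxE.
have DE : D = t *: (A' *m V') + rho *m V'.
  by rewrite -[LHS](mulmxK E'unit) scalemxAl -mulmxDl /rho addrC subrK.
have -> : (A' *m V') 0 k - t^-1 *: D 0 k = - (t^-1 * (rho *m V') 0 k).
  by rewrite DE [in X in _ - X]mxE [in X in _ - X]mxE -[_ *: (_ + _)]/(_ * _) mulrDr mulrA mulVf // mul1r opprD addrA subrr sub0r.
rewrite normrN normrM normfV ler_pdivrMl ?normr_gt0 // mxE.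
apply: le_trans (ler_norm_sum _ _ _) _.
apply: (@le_trans _ _ (\sum_i e / S * `|t| * `|V' i k|)).
  by apply: ler_sum => i _; rewrite normrM ler_wpM2r.
rewrite -mulr_sumr mulrAC mulrC ler_wpM2l // -mulrA ger_pMr // mulrC ler_pdivrMr // mul1r.
by rewrite lerDr.
Unshelve. all: end_near. Qed.

Let openU : open U.
Proof.
rewrite (_ : U = ball (0 : R) r); first exact: ball_open.
by apply/seteqP; split=> t; rewrite /U -ball_normE /= sub0r normrN.
Qed.

(* If [u] is of class C^k then so is the rational function of [(t, u)] that is its
   derivative. *)
Let Ck_u k i : Ck_on k U (fun t : R => u t 0 i).
Proof.
have cu (j : 'I_c) (s : R) : U s -> {for s, continuous (fun t => u t 0 j)}.
  move=> /(is_derive_u j)[/derivable1_diffP/differentiable_continuous].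
  exact.
elim: k i => [|k IH] i; first exact: cu.
split=> [|v]; first exact: cu.
have dv (s : R) : U s -> is_derive s v (fun t => u t 0 i)
    (v * (ev (z s) ((A *m \adj E) 0 i) / ev (z s) (\det E))).
  move=> Us; have [d1 d2] := is_derive_u i Us.
  have d3 : differentiable (fun t => u t 0 i) s by apply/derivable1_diffP.
  split; first exact: diff_derivable.
  by rewrite deriveE // deriv1E // derive1E d2.
split=> [s /dv[]//|].
have Cz j : Ck_on k U (fun t : R => z t 0 j).
  rewrite /z /pt; case: (split_ordP j) => l ->.
    by apply: Ck_eq_on (smooth_on_id openU k) => // t _; rewrite row_mxEl mxE.
  by apply: Ck_eq_on (IH l) => // t _; rewrite row_mxEr.
have C1 := Ck_on_meval_comp ((A *m \adj E) 0 i) openU Cz.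
have C2 := Ck_on_meval_comp (\det E) openU Cz.
have d0 (s : R) : U s -> ev (z s) (\det E) != 0.
  by move=> Us; have := det_unit (z_r (ltW Us)); rewrite det_map_mx.
apply: Ck_eq_on (Ck_onM openU (smooth_on_cst v openU k) (Ck_onM openU C1 (Ck_onV openU d0 C2))) => //.
by move=> s /dv[_ ->].
Qed.

Lemma polynomial_fixed_point_curve : exists (r : R) (u : R -> 'rV[R]_c),
  [/\ 0 < r, u 0 = 0, smooth_on [set t : R | `|t| < r] u,
      forall k, is_derive (0 : R) 1 (fun t : R => u t 0 k) 0 &
      forall t, `|t| < r -> u t = \row_i meval (row_mx (const_mx t : 'rV_1) (u t) 0) (q i)].
Proof.
have r0 : `|0 : R| < r by rewrite normr0.
have u0 : u 0 = 0.
  have h := Psi_lipschitz (pt_le (ltW r0) (u_r (ltW r0))) (ltac:(by rewrite normr0 ltW) : `|0 : 'rV[R]_N| <= r).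
  rewrite Psi0 -u_fix ?(ltW r0) // !subr0 in h.
  have h' : `|pt 0 (u 0)| <= `|u 0| by apply: pt_le; rewrite ?normr0.
  by apply/eqP; rewrite -normr_le0; have := normr_ge0 (u 0); lra.
exists r, u; split=> //.
- apply/smooth_on_mxP => // i j k; rewrite ord1; exact: Ck_u.
- move=> k; have := is_derive_u k r0.
  suff -> : ev (z 0) ((A *m \adj E) 0 k) = 0 by rewrite mul0r.
  rewrite mxE rmorph_sum big1 // => i _; rewrite rmorphM /= mxE.
  have -> : z 0 = 0 by rewrite /z /pt u0; apply/rowP => j; case: (split_ordP j) => l ->; rewrite ?row_mxEl ?row_mxEr !mxE.
  by rewrite dq0 mul0r.
- by move=> t /ltW tr; exact: u_fix.
Qed.

End PolynomialFixedPoint.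

(** * Curves in complete intersections *)

Section CompleteIntersectionCurves.
Variable R : realType.

Lemma open_centered (r : R) : open [set t : R | `|t| < r].
Proof.
rewrite (_ : [set t : R | _] = ball (0 : R) r); first exact: ball_open.
by apply/seteqP; split=> t; rewrite -ball_normE /= sub0r normrN.
Qed.

(** The Gram matrix is positive definite: [v J J^T v^T] is a sum of squares. *)
Lemma gram_unit c n (J : 'M[R]_(c, n)) : row_free J -> J *m J^T \in unitmx.
Proof.
move=> fJ; rewrite -row_free_unit -kermx_eq0; apply/rowV0P => v; rewrite sub_kermx => /eqP vS.
have : \sum_j (v *m J) 0 j ^+ 2 = 0.
  transitivity ((v *m (J *m J^T) *m v^T) 0 0); last by rewrite vS mul0mx mxE.
  rewrite mulmxA -mulmxA -trmx_mul [RHS]mxE.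
  by apply: eq_bigr => j _; rewrite [(_^T) j 0]mxE expr2.
move=> /eqP; rewrite psumr_eq0 => [/allP h|j _]; last exact: sqr_ge0.
have vJ : v *m J = 0.
  apply/rowP => j; rewrite [RHS]mxE; apply/eqP; rewrite -sqrf_eq0.
  exact: implyP (h j (mem_index_enum j)) isT.
by apply: (row_free_inj fJ); rewrite vJ mul0mx.
Qed.

Lemma is_derive_lincomb (V : normedModType R) I (r : seq I) (a : I -> R) (f : I -> V -> R) df (x v : V) :
  (forall k, is_derive x v (f k) (df k)) ->
  is_derive x v (fun y => \sum_(k <- r) a k * f k y) (\sum_(k <- r) a k * df k).
Proof.
move=> fdf; elim: r => [|k r IH].
  rewrite big_nil (_ : (fun y => _) = cst 0); first exact: is_derive_cst.
  by apply/funext => y; rewrite big_nil.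
rewrite big_cons (_ : (fun y => _) = (fun y => a k * f k y) +
  (fun y => \sum_(k <- r) a k * f k y)); last by apply/funext => y; rewrite big_cons.
by apply: is_deriveD; exact: is_deriveZ.
Qed.

Lemma is_derive_affine m n (y v : 'rV[R]_m) (x : 'rV[R]_n) (K : 'M[R]_(m, n)) k :
  is_derive y v (fun y : 'rV[R]_m => (x + y *m K) 0 k) ((v *m K) 0 k).
Proof.
apply: is_derive_cvg; apply: cvg_near_cst; near=> h.
have h0 : h != 0 by near: h; exact: nbhs_dnbhs_neq.
have E : x + (h *: v + y) *m K - (x + y *m K) = h *: (v *m K).
  by rewrite mulmxDl -scalemxAl opprD addrACA subrr add0r addrK.
move/matrixP/(_ 0 k): E; rewrite mxE [X in _ + X = _]mxE [RHS]mxE => ->.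
by rewrite -[_ *: _]/(_ * _) mulrA mulVf // mul1r.
Unshelve. all: end_near. Qed.

Variables (n c : nat) (g : 'I_c -> mpoly n R) (x w : 'rV[R]_n).
Let J := Defs.jacobian g x.
Hypothesis gx : forall i, meval (x 0) (g i) = 0.
Hypothesis freeJ : row_free J.
Hypothesis wJ : w *m J^T = 0.

(* The curve is sought in the form [x + t w + u J].  Its equations [g = 0] have the
   invertible differential [S = J J^T] in [u] and, as [w J^T = 0], no linear term in [t].
   Hence [q], which stands for [u - g (x + t w + u J) S^-1], has no linear part, and its
   fixed points are the solutions. *)
Let S := J *m J^T.
Let K : 'M[R]_(1 + c, n) := col_mx w J.
Let lq : n.-tuple (mpoly (1 + c) R) :=
  [tuple mpolyC _ (x 0 j) + \sum_k K k j *: mpolyX R (mnm1 k) | j < n].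
Let q (i : 'I_c) : mpoly (1 + c) R :=
  mpolyX R (mnm1 (rshift 1 i)) - \sum_k invmx S k i *: comp_mpoly lq (g k).

Let qE (v : 'rV[R]_(1 + c)) i : meval (v 0) (q i) =
  v 0 (rshift 1 i) - \sum_k invmx S k i * meval ((x + v *m K) 0) (g k).
Proof.
rewrite mevalB mevalXU; congr (_ - _); rewrite raddf_sum; apply: eq_bigr => k _ /=.
rewrite mevalZ comp_mpoly_meval; congr (_ * _); apply: meval_eq => j.
rewrite tnth_mktuple mevalD mevalC !mxE; congr (_ + _); rewrite raddf_sum /=.
by apply: eq_bigr => l _; rewrite mevalZ mevalXU mulrC.
Qed.

Let q0 i : meval ((0 : 'rV[R]_(1 + c)) 0) (q i) = 0.
Proof.
by rewrite qE mul0mx addr0 mxE big1 ?subr0 // => k _; rewrite gx mulr0.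
Qed.

Let dq0 i j : meval ((0 : 'rV[R]_(1 + c)) 0) (mderiv j (q i)) = 0.
Proof.
rewrite -partial_meval /partial; set v : 'rV[R]_(1 + c) := delta_mx 0 j.
pose G k (y : 'rV[R]_(1 + c)) : R := meval ((x + y *m K) 0) (g k).
have dG k : is_derive (0 : 'rV[R]_(1 + c)) v (G k) ((v *m K *m J^T) 0 k).
  have := is_derive_meval_comp (g k) (fun l => is_derive_affine 0 v x K l).
  rewrite mul0mx addr0 [in X in _ -> X]mxE; congr (is_derive _ _ _ _).
  by apply: eq_bigr => l _; rewrite [J^T l k]mxE [J k l]mxE.
have dX : is_derive (0 : 'rV[R]_(1 + c)) v (fun y => y 0 (rshift 1 i)) (v 0 (rshift 1 i)).
  have := is_derive_affine 0 v 0 1%:M (rshift 1 i).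
  by rewrite mulmx1; under eq_fun => y do rewrite add0r mulmx1.
have -> : (fun y : 'rV[R]_(1 + c) => meval (y 0) (q i)) =
  (fun y : 'rV[R]_(1 + c) => y 0 (rshift 1 i)) - (fun y => \sum_k invmx S k i * G k y).
  by apply/funext => y; rewrite qE.
have [_ ->] := is_deriveB dX (is_derive_lincomb (index_enum 'I_c) (fun k => invmx S k i) dG).
have vK : v *m K *m J^T *m invmx S = rsubmx v.
  rewrite -[v in LHS]hsubmxK mul_row_col mulmxDl -mulmxA wJ mulmx0 add0r -!mulmxA (mulmxA J).
  by rewrite mulmxV ?mulmx1 // gram_unit.
have -> : \sum_k invmx S k i * (v *m K *m J^T) 0 k = rsubmx v 0 i.
  by rewrite -vK [RHS]mxE; apply: eq_bigr => k _; rewrite mulrC.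
by rewrite [rsubmx v 0 i]mxE subrr.
Qed.

(** The part of the implicit function theorem that makes vectors killed by independent
differentials tangent to the set of solutions. *)
Lemma complete_intersection_curve : exists (r : R) (b : R -> 'rV[R]_n),
  [/\ 0 < r, smooth_on [set t : R | `|t| < r] b, b 0 = x, b^`()%classic 0 = w &
      forall t i, `|t| < r -> meval (b t 0) (g i) = 0].
Proof.
have [r [u [r0 u0 su du uE]]] := polynomial_fixed_point_curve q0 dq0.
pose b (t : R) : 'rV[R]_n := x + row_mx (const_mx t : 'rV_1) (u t) *m K.
have bE : b = (fun t => x + (t *: w + u t *m J)).
  apply/funext => t; rewrite /b mul_row_col; congr (_ + (_ + _)).
  by apply/rowP => j; rewrite !mxE big_ord1 mxE.
have oU : open [set t : R | `|t| < r] := open_centered (r := r).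
have db j : is_derive (0 : R) 1 (fun t => b t 0 j) (w 0 j).
  have dlin : is_derive (0 : R) 1 (fun t : R => w 0 j * t) (w 0 j * 1) :=
    is_deriveZ (w 0 j) (is_derive_id (0 : R) 1).
  have := is_deriveD (is_derive_cst (x 0 j) (0 : R) 1)
    (is_deriveD dlin (is_derive_lincomb (index_enum 'I_c) (fun k => J k j) du)).
  rewrite mulr1 [X in w 0 j + X]big1 ?addr0 ?add0r => [|k _]; last by rewrite mulr0.
  congr (is_derive _ _ _ _); apply/funext => t.
  rewrite bE !mxE -![(_ + _ : _ -> _) _]/(_ + _) /cst mulrC.
  by congr (_ + (_ + _)); apply: eq_bigr => k _; rewrite mulrC.
exists r, b; split=> //.
- apply/smooth_on_mxP => // i j; rewrite ord1.
  have s1 := smooth_onM oU (smooth_on_id oU) (smooth_on_cst (w 0 j) oU).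
  have s2 := smooth_on_sum (enum 'I_c) oU (fun k => smooth_onM oU ((smooth_on_mxP u oU).1 su 0 k) (smooth_on_cst (J k j) oU)).
  apply: smooth_on_eq (smooth_onD oU (smooth_on_cst (x 0 j) oU) (smooth_onD oU s1 s2)) => // t _.
  by rewrite bE !mxE big_enum.
- by rewrite bE u0 scale0r mul0mx !addr0.
- rewrite derive1E derive_mx.
    by apply/rowP => j; rewrite mxE; have [_ ->] := db j.
  by apply/derivable_mxP => i j; rewrite ord1; have [] := db j.
- move=> t i tr; pose G : 'rV[R]_c := \row_k meval (b t 0) (g k).
  suff : G = 0 by move=> /rowP/(_ i); rewrite !mxE.
  have : G *m invmx S = 0.
    apply/rowP => k; rewrite !mxE; have := uE t tr => /rowP/(_ k); rewrite mxE qE row_mxEr -/(b t).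
    move=> /eqP; rewrite eq_sym subr_eq addrC -subr_eq subrr eq_sym => /eqP e; rewrite -[RHS]e.
    by apply: eq_bigr => l _; rewrite mxE mulrC.
  by move=> /(congr1 (mulmxr S)) /=; rewrite mulmxKV ?mul0mx // gram_unit.
Qed.

End CompleteIntersectionCurves.

(** * Dickson's lemma and zero loci of ideals *)

Section HilbertBasis.
Variable R : realType.

(** Dickson's lemma, with the componentwise order restricted to a list of
coordinates so that it can be proved by induction on this list: if [L] answers the
question for the coordinates [r], it also covers the elements whose coordinate [c]
is at least the maximum over [L]; the remaining elements are split into finitely
many classes along the value of that coordinate. *)
Lemma dickson_coords n (r : seq 'I_n) (S : set (multinom n)) :
  exists L : seq (multinom n), (forall l, l \in L -> S l) /\
    forall m, S m -> exists2 l, l \in L & forall c, c \in r -> (l c <= m c)%N.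
Proof.
elim: r S => [|c r IH] S.
  have [[m Sm]|nS] := pselect (exists m, S m).
    by exists [:: m]; split=> [l|m' _]; [rewrite inE => /eqP ->|exists m; rewrite ?inE].
  by exists [::]; split=> // m Sm; case: nS; exists m.
have [L0 [L0S L0P]] := IH S.
(* beyond [N], the coordinate [c] is dominated by every member of [L0] *)
pose N := (\max_(l <- L0) l c)%N.
have lt_case : forall k : nat, exists L : seq (multinom n), (forall l, l \in L -> S l) /\
    forall m, S m -> (m c < k)%N -> exists2 l, l \in L & forall c', c' \in c :: r -> (l c' <= m c')%N.
  elim=> [|k [L [LS LP]]]; first by exists [::].
  have [L' [L'S L'P]] := IH [set m | S m /\ m c = k].
  exists (L ++ L'); split=> [l|m Sm].
    by rewrite mem_cat => /orP[/LS//|/L'S[]].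
  rewrite ltnS leq_eqVlt => /orP[/eqP mk|/(LP _ Sm)[l lL h]]; last first.
    by exists l; rewrite ?mem_cat ?lL.
  have [l lL h] := L'P m (conj Sm mk); exists l; first by rewrite mem_cat lL orbT.
  have [_ lk] := L'S _ lL.
  by move=> c'; rewrite inE => /orP[/eqP ->|/h//]; rewrite lk mk.
have [L1 [L1S L1P]] := lt_case N.
exists (L0 ++ L1); split=> [l|m Sm]; first by rewrite mem_cat => /orP[/L0S|/L1S].
have [/(L1P _ Sm)[l lL h]|leN] := ltnP (m c) N.
  by exists l; rewrite ?mem_cat ?lL ?orbT.
have [l lL h] := L0P m Sm; exists l; first by rewrite mem_cat lL.
move=> c'; rewrite inE => /orP[/eqP ->|/h//]; apply: leq_trans leN.
by rewrite /N (big_rem l) //= leq_maxl.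
Qed.

(** The consequence of Hilbert's basis theorem for zero loci.  By Dickson's lemma, finitely
many members have leading monomials dividing all leading monomials of the ideal;
reducing a member by them lowers its leading monomial until it vanishes. *)
Lemma ideal_zeros_finite n (I : set (mpoly n R)) :
  (forall p q, I p -> I q -> I (p + q)) -> (forall a p, I p -> I (a * p)) ->
  exists L : seq (mpoly n R), (forall q, q \in L -> I q) /\
    forall x : 'I_n -> R, (forall q, q \in L -> meval x q = 0) ->
    forall p, I p -> meval x p = 0.
Proof.
move=> ID IM.
have [Lm [LmS LmP]] := dickson_coords (enum 'I_n) [set m | exists p, [/\ I p, p != 0 & mlead p = m]].
have [f fP] : exists f : multinom n -> mpoly n R, forall m, m \in Lm ->
    [/\ I (f m), f m != 0 & mlead (f m) = m].
  have : forall m, exists p, m \in Lm -> [/\ I p, p != 0 & mlead p = m].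
    move=> m; case: (boolP (m \in Lm)) => [/LmS[p h]|_]; first by exists p.
    by exists 0.
  by move=> /choice[f fP]; exists f.
exists [seq f m | m <- Lm]; split=> [q /mapP[m mL ->]|x x0]; first by have [] := fP m mL.
elim/mleadrect => p IH Ip.
have [->|p0] := eqVneq p 0; first by rewrite meval0.
have [m mL le_m] := LmP (mlead p) (ex_intro _ p (And3 Ip p0 erefl)).
have [If f0 fm] := fP m mL.
have lemp : lem m (mlead p).
  by apply/mnm_lepP => i; apply: le_m; rewrite mem_enum.
pose c := mcoeff (mlead p) p / mcoeff m (f m).
pose a : mpoly n R := c *: mpolyX R (mnm_sub (mlead p) m).
have fx : meval x (f m) = 0 by apply: x0; apply: map_f.
have fl0 : mcoeff m (f m) != 0 by rewrite -{1}fm mleadc_eq0.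
have -> : meval x p = meval x (p - a * f m) by rewrite mevalB mevalM fx mulr0 subr0.
have Iq : I (p - a * f m) by rewrite -mulNr; apply: ID => //; exact: IM.
have [->|q0] := eqVneq (p - a * f m) 0; first by rewrite meval0.
apply: IH Iq.
have c0 : c != 0 by rewrite mulf_neq0 ?invr_eq0 // mleadc_eq0.
have X0 : mpolyX R (mnm_sub (mlead p) m) != 0.
  by rewrite -msupp_eq0 msuppX.
have la : mlead a = mnm_sub (mlead p) m by rewrite mleadZ // mleadXm.
have a0 : a != 0 by rewrite scaler_eq0 (negbTE c0).
have Em : mnm_add (mlead a) (mlead (f m)) = mlead p by rewrite la fm submK.
have leadE : mlead (a * f m) = mlead p by rewrite mleadM.
have : (mlead (p - a * f m) <= mlead p)%O.
  by apply: le_trans (mleadB_le _ _) _; rewrite leadE joinxx.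
rewrite le_eqVlt => /orP[/eqP e|//]; case/eqP: q0; apply/eqP.
rewrite -mleadc_eq0 e mcoeffB -{2}Em mleadcM fm mcoeffZ la mcoeffX eqxx mulr1.
by rewrite divfK // subrr.
Qed.

End HilbertBasis.

(** * Tangent spaces of smooth varieties *)

Section SmoothVarieties.
Variables (R : realType) (n : nat).
Local Notation ev x := (meval ((x : 'rV[R]_n) 0)).

Definition dirder (w x : 'rV[R]_n) (p : mpoly n R) : R := \sum_j w 0 j * ev x (mderiv j p).

Lemma dirderM w x p q : dirder w x (p * q) = ev x p * dirder w x q + ev x q * dirder w x p.
Proof.
rewrite /dirder !mulr_sumr -big_split; apply: eq_bigr => j _ /=.
by rewrite mderivM mevalD !mevalM; ring.
Qed.

Lemma dirder_sum w x I (r : seq I) (P : pred I) (p : I -> mpoly n R) :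
  dirder w x (\sum_(i <- r | P i) p i) = \sum_(i <- r | P i) dirder w x (p i).
Proof.
rewrite /dirder exchange_big; apply: eq_bigr => j _ /=.
by rewrite -mulr_sumr (raddf_sum (mderiv j)) (raddf_sum (meval (x 0))).
Qed.

Lemma jacobian_kernelP k (f : 'I_k -> mpoly n R) (x w : 'rV[R]_n) :
  w *m (Defs.jacobian f x)^T = 0 <-> forall i, dirder w x (f i) = 0.
Proof.
have E i : (w *m (Defs.jacobian f x)^T) 0 i = dirder w x (f i).
  by rewrite mxE; apply: eq_bigr => j _; rewrite !mxE.
split=> [h i|h]; first by rewrite -E h mxE.
by apply/rowP => i; rewrite E h mxE.
Qed.

Lemma in_ideal_eq0 k (f : 'I_k -> mpoly n R) p x :
  in_ideal f p -> (forall j, ev x (f j) = 0) -> ev x p = 0.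
Proof.
move=> [a ->] f0; rewrite raddf_sum big1 // => j _ /=.
by rewrite mevalM f0 mulr0.
Qed.

Lemma in_ideal_dirder k (f : 'I_k -> mpoly n R) p w x : in_ideal f p ->
  (forall j, ev x (f j) = 0) -> (forall j, dirder w x (f j) = 0) -> dirder w x p = 0.
Proof.
move=> [a ->] f0 df0; rewrite dirder_sum big1 // => j _.
by rewrite dirderM f0 df0 mul0r mulr0 addr0.
Qed.

Variables (k : nat) (f : 'I_k -> mpoly n R).
Local Notation M := (zero_locus f).

(** Differentiate [f j = 0] along a curve. *)
Lemma tangent_kernel x w : tangent M x w -> forall j, dirder w x (f j) = 0.
Proof.
move=> [J [b [[oJ J0] sb bM b0 b'0]]] j.
have db : derivable b (0 : R) 1 by exact: smooth_on_derivable sb J0.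
have dbj i : is_derive (0 : R) 1 (fun t => b t 0 i) (w 0 i).
  split; first by move/derivable_mxP: db.
  by rewrite -b'0 derive1E derive_mx // mxE.
have [_ E] := is_derive_meval_comp (f j) dbj.
rewrite b0 in E; rewrite /dirder -E.
rewrite (@derive_eq_on _ _ _ J _ (cst 0)) ?derive_cst // => t Jt.
by have : M (b t) by apply: bM; exists t.
Qed.

Hypothesis sm : smooth_variety f.

(** Near [x] the variety is the zero locus of the independent equations [g], because [h]
does not vanish there; so the curve of [complete_intersection_curve] lies in it. *)
Lemma kernel_tangent x w : M x -> (forall j, dirder w x (f j) = 0) -> tangent M x w.
Proof.
move=> Mx wf; have [c [g [h [gf freeJ hx hf]]]] := sm Mx.
have gx i : ev x (g i) = 0 by apply: in_ideal_eq0 (gf i) _.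
have wg : w *m (Defs.jacobian g x)^T = 0.
  by apply/jacobian_kernelP => i; exact: in_ideal_dirder (gf i) _ _.
have [r [b [r0 sb b0 db gb]]] := complete_intersection_curve gx freeJ wg.
have rU : `|0 : R| < r by rewrite normr0.
have cb := smooth_on_continuous sb rU.
have chb : {for (0 : R), continuous (fun t => ev (b t) h)}.
  exact: continuous_comp cb (@continuous_meval R n h _).
have h00 : 0 < `|ev x h| / 2 by rewrite divr_gt0 // normr_gt0.
have [d d0 dP] := continuous_dist chb h00.
have d'0 : 0 < Num.min r d by rewrite lt_min r0.
exists [set t : R | `|t| < Num.min r d], b; split=> //.
- by split; [exact: open_centered|rewrite /= normr0].
- by apply: smooth_on_sub sb => t /=; rewrite lt_min => /andP[].
- move=> _ [t + <-] j; rewrite /= lt_min => /andP[tr td].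
  have : ev (b t) (h * f j) = 0 by apply: in_ideal_eq0 (hf j) _ => i; exact: gb.
  rewrite mevalM => /eqP; rewrite mulf_eq0 => /orP[/eqP h0|/eqP //].
  have := dP t; rewrite subr0 => /(_ td); rewrite h0 b0 sub0r normrN.
  have : 0 < `|ev x h| by rewrite normr_gt0.
  lra.
Qed.

(* The denominators [Q] for which the tangent spaces have a polynomial spanning matrix:
   the rows of [W] are tangent everywhere, and [W] acts on tangent vectors as the
   scalar [Q].  They form an ideal. *)
Let I (Q : mpoly n R) := exists W : 'M[mpoly n R]_n, forall x, M x ->
  (forall i j, dirder (row i (map_mx (ev x) W)) x (f j) = 0) /\
  (forall w, (forall j, dirder w x (f j) = 0) -> w *m map_mx (ev x) W = ev x Q *: w).

Lemma dirderZ a w x p : dirder (a *: w) x p = a * dirder w x p.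
Proof. by rewrite mulr_sumr; apply: eq_bigr => j _; rewrite mxE mulrA. Qed.

Lemma dirderD v w x p : dirder (v + w) x p = dirder v x p + dirder w x p.
Proof. by rewrite -big_split; apply: eq_bigr => j _; rewrite mxE mulrDl. Qed.

Let I_add p q : I p -> I q -> I (p + q).
Proof.
move=> [W hW] [V hV]; exists (W + V) => x Mx.
have [W1 W2] := hW x Mx; have [V1 V2] := hV x Mx; rewrite map_mxD; split=> [i j|w w0].
  by rewrite linearD dirderD W1 V1 addr0.
by rewrite mulmxDr W2 // V2 // mevalD scalerDl.
Qed.

Let I_mul a p : I p -> I (a * p).
Proof.
move=> [W hW]; exists (a *: W) => x Mx; have [W1 W2] := hW x Mx.
rewrite map_mxZ; split=> [i j|w w0]; first by rewrite linearZ /= dirderZ W1 mulr0.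
by rewrite -scalemxAr W2 // scalerA mevalM.
Qed.

(* Near [x] the orthogonal projection onto the kernel of the differential [G] of [g] is
   [1 - G^T (G G^T)^-1 G]; [D] clears the denominator.  The factor [h] makes the matrix vanish
   at the points where the differentials of [g] and [f] may differ. *)
Let I_local x : M x -> exists2 Q, I Q & ev x Q != 0.
Proof.
move=> Mx; have [c [g [h [gf freeJ hx hf]]]] := sm Mx.
pose G : 'M[mpoly n R]_(c, n) := \matrix_(i, j) mderiv j (g i).
have GE y : map_mx (ev y) G = Defs.jacobian g y by apply/matrixP => i j; rewrite !mxE.
pose D := \det (G *m G^T).
exists (h * D); last first.
  rewrite mevalM mulf_neq0 // -det_map_mx map_mxM -map_trmx GE -unitfE -unitmxE.
  exact: gram_unit.
exists (h *: (D%:M - G^T *m \adj (G *m G^T) *m G)) => y My.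
set W := D%:M - _.
have gy i : ev y (g i) = 0 by apply: in_ideal_eq0 (gf i) _.
have WG : W *m G^T = 0.
  by rewrite mulmxBl mul_scalar_mx -!mulmxA mul_adj_mx mul_mx_scalar subrr.
split=> [i j|w w0].
  have : dirder (row i (map_mx (ev y) W)) y (h * f j) = 0.
    apply: in_ideal_dirder (hf j) gy _; apply/jacobian_kernelP.
    by rewrite -GE map_trmx -row_mul -map_mxM WG map_mx0 linear0.
  rewrite dirderM My mul0r addr0 map_mxZ linearZ /= dirderZ.
  by move=> ->.
have wG : w *m map_mx (ev y) G^T = 0.
  by rewrite -map_trmx GE; apply/jacobian_kernelP => i; exact: in_ideal_dirder (gf i) My w0.
rewrite map_mxZ -scalemxAr map_mxB !map_mxM mulmxBr !mulmxA wG !mul0mx subr0.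
by rewrite map_scalar_mx mul_mx_scalar scalerA mevalM.
Qed.

(** The ideal above has no zero on the variety.  Finitely many members suffice for this
([ideal_zeros_finite]), and the sum of their squares is a member that is positive on
the whole variety. *)
Lemma spanning_tangent_matrix : exists (Q : mpoly n R) (W : 'M[mpoly n R]_n), forall x, M x ->
  [/\ 0 < ev x Q, forall i, tangent M x (row i (map_mx (ev x) W)) &
      forall w, tangent M x w -> w *m map_mx (ev x) W = ev x Q *: w].
Proof.
have [L [LI Lz]] := ideal_zeros_finite I_add I_mul.
have I0 : I 0.
  exists 0 => x Mx; rewrite map_mx0; split=> [i j|w _]; last by rewrite mulmx0 meval0 scale0r.
  by rewrite linear0 /dirder big1 // => l _; rewrite mxE mul0r.
have [W hW] : I (\sum_(q <- L) q * q).
  by elim: (L) LI => [|q l IH] lI; rewrite ?big_nil ?big_cons //; apply: I_add;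
    [apply: I_mul; apply: lI; rewrite mem_head|apply: IH => p pl; apply: lI; rewrite inE pl orbT].
exists (\sum_(q <- L) q * q), W => x Mx; have [W1 W2] := hW x Mx; split.
- have [Q IQ Qx] := I_local Mx.
  rewrite raddf_sum /= lt_neqAle sumr_ge0 => [|q _]; last by rewrite mevalM -expr2 sqr_ge0.
  rewrite andbT eq_sym; apply/eqP => s0; case/eqP: Qx; apply: Lz IQ => q qL.
  move/eqP: s0; rewrite big_seq psumr_eq0 => [/allP/(_ q qL)|p _].
    by rewrite qL /= mevalM mulf_eq0 orbb => /eqP.
  by rewrite mevalM -expr2 sqr_ge0.
- by move=> i; apply: kernel_tangent.
- by move=> w /tangent_kernel; exact: W2.
Qed.

End SmoothVarieties.

(** * Semialgebraic sets and quantifier elimination *)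

Section TarskiSeidenberg.
Variable R : realType.
Implicit Types (n k : nat).

Definition coords n (x : 'rV[R]_n) : seq R := [seq x 0 i | i <- enum 'I_n].

Lemma size_coords n (x : 'rV[R]_n) : size (coords x) = n.
Proof. by rewrite size_map size_enum_ord. Qed.

Lemma nth_coords n (x : 'rV[R]_n) (i : 'I_n) : nth 0 (coords x) i = x 0 i.
Proof. by rewrite (nth_map i) ?size_enum_ord // nth_ord_enum. Qed.

Lemma coords_row_mx n k (x : 'rV[R]_n) (y : 'rV[R]_k) :
  coords (row_mx x y) = coords x ++ coords y.
Proof.
apply: (@eq_from_nth _ 0) => [|i]; first by rewrite size_cat !size_coords.
rewrite size_coords => lti; rewrite (nth_coords _ (Ordinal lti)) nth_cat size_coords.
rewrite mxE; case: split_ordP => j /(congr1 val) /= ->.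
  by rewrite ltn_ord nth_coords.
by rewrite ltnNge leq_addr /= addKn nth_coords.
Qed.

Lemma coords_onto n (s : seq R) : size s = n -> exists x : 'rV[R]_n, coords x = s.
Proof.
move=> szs; exists (\row_i nth 0 s i).
apply: (@eq_from_nth _ 0); rewrite size_coords // => i lti.
by rewrite (nth_coords _ (Ordinal lti)) mxE.
Qed.

(** Sets described by first order formulas with quantifiers, evaluated at the list of
coordinates; they turn out to be the semialgebraic sets. *)
Definition definable n (A : set 'rV[R]_n) : Prop :=
  exists f : ord.formula R, forall x, A x <-> ord.holds (coords x) f.

Lemma term_meval n (t : GRing.term R) : GRing.rterm t ->
  exists p : mpoly n R, forall x, GRing.eval (coords x) t = meval (x 0) p.
Proof.
elim: t => //=.
- move=> i _; case: (ltnP i n) => [lti|lei].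
    exists (mpolyX R (mnm1 (Ordinal lti))) => x.
    by rewrite mevalXU -(nth_coords _ (Ordinal lti)).
  by exists 0 => x; rewrite meval0 nth_default ?size_coords.
- by move=> r _; exists (mpolyC n r) => x; rewrite mevalC.
- by move=> m _; exists (mpolyC n m%:R) => x; rewrite mevalC.
- move=> t1 IH1 t2 IH2 /andP[/IH1[p1 e1] /IH2[p2 e2]].
  by exists (p1 + p2) => x; rewrite e1 e2 mevalD.
- by move=> t1 IH1 /IH1[p1 e1]; exists (- p1) => x; rewrite e1 mevalN.
- by move=> t1 IH1 m /IH1[p1 e1]; exists (p1 *+ m) => x; rewrite e1 mevalMn.
- move=> t1 IH1 t2 IH2 /andP[/IH1[p1 e1] /IH2[p2 e2]].
  by exists (p1 * p2) => x; rewrite e1 e2 mevalM.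
- by move=> t1 IH1 m /IH1[p1 e1]; exists (p1 ^+ m) => x; rewrite e1 rmorphXn.
Qed.

Lemma meval_term n (p : mpoly n R) :
  exists t : GRing.term R, forall x, GRing.eval (coords x) t = meval (x 0) p.
Proof.
elim/mpolyind: p => [|c m p _ _ [t et]].
  by exists (GRing.NatConst _ 0) => x; rewrite meval0.
have [u eu] : exists u, forall x : 'rV[R]_n,
    GRing.eval (coords x) u = \prod_i x 0 i ^+ m i.
  suff [u eu] : exists u, forall x : 'rV[R]_n,
      GRing.eval (coords x) u = \prod_(i <- enum 'I_n) x 0 i ^+ m i.
    by exists u => x; rewrite eu big_enum.
  elim: (enum _) => [|i s [u eu]].
    by exists (GRing.NatConst _ 1) => x; rewrite big_nil.
  exists (GRing.Mul (GRing.Exp (GRing.Var _ i) (m i)) u) => x /=.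
  by rewrite big_cons eu nth_coords.
exists (GRing.Add (GRing.Mul (GRing.Const c) u) t) => x /=.
by rewrite mevalD mevalZ mevalX eu et.
Qed.

Lemma semialgebraic_ext n (A B : set 'rV[R]_n) :
  (forall x, A x <-> B x) -> semialgebraic A -> semialgebraic B.
Proof. by move=> AB; have -> : B = A by apply/seteqP; split=> x /AB. Qed.

Lemma semialgebraic_eq0 n (p : mpoly n R) :
  semialgebraic [set x : 'rV[R]_n | meval (x 0) p = 0].
Proof.
exists [:: ([:: p], [::])]; apply/seteqP.
by split=> x /=; rewrite andbT orbF andbT => /eqP.
Qed.

Lemma semialgebraic_gt0 n (p : mpoly n R) :
  semialgebraic [set x : 'rV[R]_n | 0 < meval (x 0) p].
Proof.
exists [:: ([::], [:: p])]; apply/seteqP.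
by split=> x /=; rewrite orbF andbT.
Qed.

Lemma semialgebraic0 n : semialgebraic (@set0 'rV[R]_n).
Proof. by exists [::]; apply/seteqP; split. Qed.

Lemma semialgebraicT n : semialgebraic [set: 'rV[R]_n].
Proof. by exists [:: ([::], [::])]; apply/seteqP; split. Qed.

Lemma semialgebraicU n (A B : set 'rV[R]_n) :
  semialgebraic A -> semialgebraic B -> semialgebraic (A `|` B).
Proof.
move=> [s ->] [t ->]; exists (s ++ t); apply/seteqP.
by split=> x /=; rewrite has_cat => /orP.
Qed.

Lemma semialgebraicI n (A B : set 'rV[R]_n) :
  semialgebraic A -> semialgebraic B -> semialgebraic (A `&` B).
Proof.
move=> [s ->] [t ->].
exists [seq (u.1 ++ v.1, u.2 ++ v.2) | u <- s, v <- t]; apply/seteqP.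
split=> x /=.
  move=> [/hasP[u us /andP[u1 u2]] /hasP[v vt /andP[v1 v2]]].
  apply/hasP; exists (u.1 ++ v.1, u.2 ++ v.2); first by apply: allpairs_f.
  by rewrite /= !all_cat u1 v1 u2 v2.
move=> /hasP[w /allpairsP[[u v] [us vt ->]]] /=.
rewrite !all_cat -!andbA => /and4P[u1 v1 u2 v2].
by split; apply/hasP; [exists u|exists v] => //; apply/andP.
Qed.

Lemma semialgebraic_forall n (I : finType) (A : I -> set 'rV[R]_n) :
  (forall i, semialgebraic (A i)) -> semialgebraic [set x | forall i, A i x].
Proof.
move=> sA; suff : semialgebraic [set x | forall i, i \in enum I -> A i x].
  by apply: semialgebraic_ext => x; split=> h i; [apply: h; rewrite mem_enum|move=> _; apply: h].
elim: (enum I) => [|i r IH].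
  by apply: semialgebraic_ext (semialgebraicT n) => x; split.
apply: semialgebraic_ext (semialgebraicI (sA i) IH) => x /=.
split=> [[Ai Ar] j|h].
  by rewrite inE => /orP[/eqP ->|/Ar].
by split=> [|j jr]; apply: h; rewrite inE ?eqxx ?jr ?orbT.
Qed.

Lemma semialgebraicC n (A : set 'rV[R]_n) : semialgebraic A -> semialgebraic (~` A).
Proof.
move=> [s ->]; elim: s => [|[u v] s IH].
  by apply: semialgebraic_ext (semialgebraicT n) => x /=.
have C_eq0 p : semialgebraic [set x : 'rV[R]_n | meval (x 0) p <> 0].
  apply: semialgebraic_ext (semialgebraicU (semialgebraic_gt0 p) (semialgebraic_gt0 (- p))) => x /=.
  rewrite mevalN oppr_gt0; split=> [[|] h e|/eqP]; [by rewrite e ltxx in h..|].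
  by rewrite neq_lt => /orP[]; [right|left].
have C_gt0 p : semialgebraic [set x : 'rV[R]_n | ~ 0 < meval (x 0) p].
  apply: semialgebraic_ext (semialgebraicU (semialgebraic_eq0 p) (semialgebraic_gt0 (- p))) => x /=.
  rewrite mevalN oppr_gt0; split=> [[->|h]|/negP]; rewrite ?ltxx //.
    by apply/negP; rewrite -leNgt ltW.
  by rewrite -leNgt le_eqVlt => /orP[/eqP|]; [left|right].
have Cu : semialgebraic [set x : 'rV[R]_n | ~ all (fun g => meval (x 0) g == 0) u].
  elim: u => [|p u IHu]; first by apply: semialgebraic_ext (semialgebraic0 n) => x /=; split=> // /(_ isT).
  apply: semialgebraic_ext (semialgebraicU (C_eq0 p) IHu) => x /=.
  split=> [[h|h]|h]; try by move=> /andP[/eqP ? ?].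
  by case: eqP h => [_|] /=; [right|left].
have Cv : semialgebraic [set x : 'rV[R]_n | ~ all (fun f => 0 < meval (x 0) f) v].
  elim: v {Cu} => [|p v IHv]; first by apply: semialgebraic_ext (semialgebraic0 n) => x /=; split=> // /(_ isT).
  apply: semialgebraic_ext (semialgebraicU (C_gt0 p) IHv) => x /=.
  split=> [[h|h]|h]; try by move=> /andP[? ?].
  by case: (ltP 0 (meval (x 0) p)) h => [_|_ _] /=; [right|left].
apply: semialgebraic_ext (semialgebraicI (semialgebraicU Cu Cv) IH) => x /=.
split=> [[h1 h2]|h]; last first.
  split; last by move=> h'; apply: h; rewrite h' orbT.
  case: (boolP (all _ u)) h => /= hu h; last by left; exact/negP.
  by right=> h'; apply: h; rewrite h'.
by move=> /orP[/andP[hu hv]|//]; case: h1.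
Qed.

Lemma semialgebraic_qf n (f : ord.formula R) :
  ord.qf_form f && ord.rformula f ->
  semialgebraic [set x : 'rV[R]_n | ord.qf_eval (coords x) f].
Proof.
elim: f => //=.
- move=> [] _.
    by apply: semialgebraic_ext (semialgebraicT n) => x.
  by apply: semialgebraic_ext (semialgebraic0 n) => x; split.
- move=> t u /andP[/(term_meval n)[p ep] /(term_meval n)[q eq]].
  apply: semialgebraic_ext (semialgebraic_eq0 (p - q)) => x /=.
  by rewrite mevalB ep eq; split=> [/eqP|/eqP e]; rewrite ?subr_eq0 // e subrr.
- move=> t u /andP[/(term_meval n)[p ep] /(term_meval n)[q eq]].
  apply: semialgebraic_ext (semialgebraic_gt0 (q - p)) => x /=.
  by rewrite mevalB ep eq subr_gt0.
- move=> t u /andP[/(term_meval n)[p ep] /(term_meval n)[q eq]].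
  apply: semialgebraic_ext (semialgebraicC (semialgebraic_gt0 (p - q))) => x /=.
  by rewrite mevalB ep eq subr_gt0 leNgt; split=> /negP.
- move=> f IHf g IHg /andP[/andP[qf qg] /andP[rf rg]].
  apply: semialgebraic_ext (semialgebraicI (IHf _) (IHg _)) => [x||]; rewrite ?qf ?qg //.
  by split=> /= [[-> ->]|/andP].
- move=> f IHf g IHg /andP[/andP[qf qg] /andP[rf rg]].
  apply: semialgebraic_ext (semialgebraicU (IHf _) (IHg _)) => [x||]; rewrite ?qf ?qg //.
  by split=> /= [/orP|/orP].
- move=> f IHf g IHg /andP[/andP[qf qg] /andP[rf rg]].
  apply: semialgebraic_ext (semialgebraicU (semialgebraicC (IHf _)) (IHg _)) => [x||];
    rewrite ?qf ?qg //.
  by rewrite /= implybE; split=> [[/negP ->//|->]|/orP[/negP|]]; rewrite ?orbT //; [left|right].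
- move=> f IHf h; apply: semialgebraic_ext (semialgebraicC (IHf h)) => x /=.
  by split=> /negP.
Qed.

Lemma definable_semialgebraic n (A : set 'rV[R]_n) : definable A -> semialgebraic A.
Proof.
move=> [f Af]; have rf := ord.to_rform_rformula f.
have := semialgebraic_qf n (ord.quantifier_elim_wf (@wf_QE_wproj R) rf).
apply: semialgebraic_ext => x /=.
have P := rcf_satP (coords x) f.
by split=> h; [apply/Af/P|apply/P/Af].
Qed.

Lemma semialgebraic_definable n (A : set 'rV[R]_n) : semialgebraic A -> definable A.
Proof.
move=> [s ->]; elim: s => [|[u v] s [f ef]].
  by exists (ord.Bool false).
have [g eg] : definable [set x : 'rV[R]_n | all (fun g => meval (x 0) g == 0) u].
  elim: u => [|p u [g eg]]; first by exists (ord.Bool true).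
  have [t et] := meval_term p.
  exists (ord.And (ord.Equal t (GRing.NatConst _ 0)) g) => x /=.
  by rewrite et -eg; split=> [/andP[/eqP ->]|[/eqP -> ]].
have [h eh] : definable [set x : 'rV[R]_n | all (fun g => 0 < meval (x 0) g) v].
  elim: v => [|p v [h eh]]; first by exists (ord.Bool true).
  have [t et] := meval_term p.
  exists (ord.And (ord.Lt (GRing.NatConst _ 0) t) h) => x /=.
  by rewrite et -eh; split=> [/andP[->]|[-> ]].
exists (ord.Or (ord.And g h) f) => x /=.
by rewrite -eg -eh -ef /=; split=> [/orP[/andP|]|[[-> ->]|->]]; rewrite ?orbT //; by [left|right].
Qed.

(** The Tarski-Seidenberg theorem: describe the set by a formula, quantify the last [k]
variables, and eliminate the quantifiers. *)
Lemma semialgebraic_exists n k (A : set 'rV[R]_(n + k)) : semialgebraic A ->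
  semialgebraic [set x : 'rV[R]_n | exists y, A (row_mx x y)].
Proof.
move=> /semialgebraic_definable[f ef]; apply: definable_semialgebraic.
exists (foldr (fun i g => ord.Exists i g) f (iota n k)) => x.
have aux (e : seq R) : ord.holds e (foldr (fun i g => ord.Exists i g) f (iota (size e) k)) <->
    exists s, size s = k /\ ord.holds (e ++ s) f.
  elim: k e {A ef x} => [|k IH] e /=.
    split=> [h|[s [/size0nil ->]]]; last by rewrite cats0.
    by exists [::]; rewrite cats0.
  have E r : set_nth 0 e (size e) r = rcons e r.
    by elim: e {IH} => //= a e ->.
  split=> [[r]|[[|r s] [] // [szs] h]].
    rewrite E; have := IH (rcons e r); rewrite size_rcons => -[IH' _] /IH'[s [<- h]].
    by exists (r :: s); rewrite -cat_rcons.
  exists r; rewrite E; have := IH (rcons e r); rewrite size_rcons => -[_]; apply.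
  by exists s; rewrite cat_rcons.
have := aux (coords x); rewrite size_coords => -> /=.
split=> [[y /ef h]|[s [/coords_onto [y <-] h]]].
  by exists (coords y); rewrite size_coords -coords_row_mx.
by exists y; apply/ef; rewrite coords_row_mx.
Qed.

End TarskiSeidenberg.

(** * Polynomial maps and sets given by first order formulas *)

Section PolynomialMaps.
Variable R : realType.

Definition polyfun n (f : 'rV[R]_n -> R) :=
  exists p : mpoly n R, forall x, f x = meval (x 0) p.

Definition polymap n m (T : 'rV[R]_n -> 'rV[R]_m) := forall i, polyfun (fun x => T x 0 i).

Lemma polyfunC n c : polyfun (fun _ : 'rV[R]_n => c).
Proof. by exists (mpolyC n c) => x; rewrite mevalC. Qed.

Lemma polyfunD n (f g : 'rV[R]_n -> R) : polyfun f -> polyfun g -> polyfun (fun x => f x + g x).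
Proof. by move=> [p fp] [q gq]; exists (p + q) => x; rewrite mevalD fp gq. Qed.

Lemma polyfunN n (f : 'rV[R]_n -> R) : polyfun f -> polyfun (fun x => - f x).
Proof. by move=> [p fp]; exists (- p) => x; rewrite mevalN fp. Qed.

Lemma polyfunB n (f g : 'rV[R]_n -> R) : polyfun f -> polyfun g -> polyfun (fun x => f x - g x).
Proof. by move=> pf pg; apply: polyfunD => //; exact: polyfunN. Qed.

Lemma polyfunM n (f g : 'rV[R]_n -> R) : polyfun f -> polyfun g -> polyfun (fun x => f x * g x).
Proof. by move=> [p fp] [q gq]; exists (p * q) => x; rewrite mevalM fp gq. Qed.

Lemma polyfunX n (f : 'rV[R]_n -> R) k : polyfun f -> polyfun (fun x => f x ^+ k).
Proof. by move=> [p fp]; exists (p ^+ k) => x; rewrite rmorphXn /= fp. Qed.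

Lemma polyfun_sum n I (r : seq I) (P : pred I) (f : I -> 'rV[R]_n -> R) :
  (forall i, polyfun (f i)) -> polyfun (fun x => \sum_(i <- r | P i) f i x).
Proof.
move=> pf; elim: r => [|i r IH].
  by exists 0 => x; rewrite big_nil meval0.
have [p e] := IH; have [q eq] := pf i; case: (boolP (P i)) => Pi.
  by exists (q + p) => x; rewrite big_cons Pi mevalD e eq.
by exists p => x; rewrite big_cons (negbTE Pi) e.
Qed.

Lemma polyfun_coord n m (T : 'rV[R]_n -> 'rV[R]_m) i : polymap T -> polyfun (fun x => T x 0 i).
Proof. exact. Qed.

Lemma polyfun_meval n m (T : 'rV[R]_n -> 'rV[R]_m) p : polymap T -> polyfun (fun x => meval (T x 0) p).
Proof.
move=> /choice[q Tq]; exists (comp_mpoly [tuple q i | i < m] p) => x.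
by rewrite comp_mpoly_meval; apply: meval_eq => i; rewrite Tq tnth_mktuple.
Qed.

Lemma polymap_id n : polymap (fun x : 'rV[R]_n => x).
Proof. by move=> i; exists (mpolyX R (mnm1 i)) => x; rewrite mevalXU. Qed.

Lemma polymap_lsubmx n m k (T : 'rV[R]_n -> 'rV[R]_(m + k)) :
  polymap T -> polymap (fun x => lsubmx (T x)).
Proof. by move=> pT i; have [p e] := pT (lshift k i); exists p => x; rewrite mxE e. Qed.

Lemma polymap_rsubmx n m k (T : 'rV[R]_n -> 'rV[R]_(m + k)) :
  polymap T -> polymap (fun x => rsubmx (T x)).
Proof. by move=> pT i; have [p e] := pT (rshift m i); exists p => x; rewrite mxE e. Qed.

Lemma polymap_row_mx n m k (T : 'rV[R]_n -> 'rV[R]_m) (U : 'rV[R]_n -> 'rV[R]_k) :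
  polymap T -> polymap U -> polymap (fun x => row_mx (T x) (U x)).
Proof.
move=> pT pU i; case: (split_ordP i) => j ->.
  by have [p e] := pT j; exists p => x; rewrite row_mxEl e.
by have [p e] := pU j; exists p => x; rewrite row_mxEr e.
Qed.

Lemma polymap_const n m (f : 'rV[R]_n -> R) : polyfun f -> polymap (fun x => const_mx (f x) : 'rV[R]_m).
Proof. by move=> [p e] i; exists p => x; rewrite mxE. Qed.

Lemma polymapB n m (T U : 'rV[R]_n -> 'rV[R]_m) : polymap T -> polymap U -> polymap (fun x => T x - U x).
Proof.
move=> pT pU i; have [p e] := polyfunB (pT i) (pU i); exists p => x.
by rewrite !mxE e.
Qed.

Lemma polymap_comp n m k (T : 'rV[R]_m -> 'rV[R]_k) (U : 'rV[R]_n -> 'rV[R]_m) :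
  polymap T -> polymap U -> polymap (fun x => T (U x)).
Proof.
move=> pT pU i; have [p e] := pT i; have [q e'] := polyfun_meval p pU.
by exists q => x; rewrite e e'.
Qed.

(** Squared Euclidean length: unlike the norm of row vectors it is polynomial. *)
Definition sqlen n (x : 'rV[R]_n) : R := \sum_i x 0 i ^+ 2.

Lemma polyfun_sqlen n m (T : 'rV[R]_n -> 'rV[R]_m) : polymap T -> polyfun (fun x => sqlen (T x)).
Proof. by move=> pT; apply: polyfun_sum => i; apply: polyfunX; apply: pT. Qed.

Lemma sqlen_ge0 n (x : 'rV[R]_n) : 0 <= sqlen x.
Proof. by apply: sumr_ge0 => i _; exact: sqr_ge0. Qed.

Lemma semialgebraic_preimage n m (A : set 'rV[R]_m) (T : 'rV[R]_n -> 'rV[R]_m) :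
  polymap T -> semialgebraic A -> semialgebraic [set x | A (T x)].
Proof.
move=> /choice[q Tq] [s ->].
pose c p := comp_mpoly [tuple q i | i < m] p.
have cE (x : 'rV[R]_n) p : meval (x 0) (c p) = meval (T x 0) p.
  by rewrite comp_mpoly_meval; apply: meval_eq => i; rewrite Tq tnth_mktuple.
exists [seq (map c u.1, map c u.2) | u <- s]; apply/seteqP.
have E (x : 'rV[R]_n) : has (fun gf => all (fun g => meval (x 0) g == 0) gf.1 &&
           all (fun f => 0 < meval (x 0) f) gf.2) [seq (map c u.1, map c u.2) | u <- s] =
   has (fun gf => all (fun g => meval (T x 0) g == 0) gf.1 &&
           all (fun f => 0 < meval (T x 0) f) gf.2) s.
  rewrite has_map; apply: eq_has => u /=; rewrite !all_map.
  by congr (_ && _); apply: eq_all => p /=; rewrite cE.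
by split=> x /=; rewrite E.
Qed.

Lemma semialgebraic_poly_eq n (f g : 'rV[R]_n -> R) : polyfun f -> polyfun g ->
  semialgebraic [set x | f x = g x].
Proof.
move=> [p fp] [q gq]; apply: semialgebraic_ext (semialgebraic_eq0 (p - q)) => x /=.
by rewrite mevalB fp gq; split=> [/eqP|->]; rewrite ?subrr // subr_eq0 => /eqP.
Qed.

Lemma semialgebraic_poly_lt n (f g : 'rV[R]_n -> R) : polyfun f -> polyfun g ->
  semialgebraic [set x | f x < g x].
Proof.
move=> [p fp] [q gq]; apply: semialgebraic_ext (semialgebraic_gt0 (q - p)) => x /=.
by rewrite mevalB fp gq subr_gt0.
Qed.

Lemma semialgebraic_poly_le n (f g : 'rV[R]_n -> R) : polyfun f -> polyfun g ->
  semialgebraic [set x | f x <= g x].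
Proof.
move=> pf pg; apply: semialgebraic_ext (semialgebraicC (semialgebraic_poly_lt pg pf)) => x /=.
by split=> [/negP|h]; rewrite -?leNgt //; apply/negP; rewrite -leNgt.
Qed.

Lemma semialgebraic_imp n (A B : set 'rV[R]_n) : semialgebraic A -> semialgebraic B ->
  semialgebraic [set x | A x -> B x].
Proof.
move=> sA sB; apply: semialgebraic_ext (semialgebraicU (semialgebraicC sA) sB) => x /=.
split=> [[]//|h]; case: (pselect (A x)) => [/h|]; [by right|by left].
Qed.

(** The variables of a formula are the blocks of a row vector: a quantifier binds the last
block, so that a set defined by a formula with quantifiers is shown to be semialgebraic
by peeling the formula. *)
Lemma semialgebraic_ex n k (P : 'rV[R]_n -> 'rV[R]_k -> Prop) :
  semialgebraic [set z : 'rV[R]_(n + k) | P (lsubmx z) (rsubmx z)] ->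
  semialgebraic [set x | exists y, P x y].
Proof.
move=> /semialgebraic_exists; apply: semialgebraic_ext => x /=.
by split=> -[y h]; exists y; move: h; rewrite row_mxKl row_mxKr.
Qed.

Lemma semialgebraic_all n k (P : 'rV[R]_n -> 'rV[R]_k -> Prop) :
  semialgebraic [set z : 'rV[R]_(n + k) | P (lsubmx z) (rsubmx z)] ->
  semialgebraic [set x | forall y, P x y].
Proof.
move=> /semialgebraicC sP; apply: semialgebraic_ext (semialgebraicC
  (@semialgebraic_ex n k (fun x y => ~ P x y) sP)) => x /=.
split=> [h y|h [y]]; last by apply.
by apply: contrapT => nP; apply: h; exists y.
Qed.

Lemma semialgebraic_ex1 n (P : 'rV[R]_n -> R -> Prop) :
  semialgebraic [set z : 'rV[R]_(n + 1) | P (lsubmx z) (rsubmx z 0 0)] ->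
  semialgebraic [set x | exists y, P x y].
Proof.
move=> /(@semialgebraic_ex n 1 (fun x y => P x (y 0 0))).
apply: semialgebraic_ext => x /=; split=> -[y Py]; first by exists (y 0 0).
by exists (const_mx y); rewrite mxE.
Qed.

Lemma semialgebraic_all1 n (P : 'rV[R]_n -> R -> Prop) :
  semialgebraic [set z : 'rV[R]_(n + 1) | P (lsubmx z) (rsubmx z 0 0)] ->
  semialgebraic [set x | forall y, P x y].
Proof.
move=> /(@semialgebraic_all n 1 (fun x y => P x (y 0 0))).
apply: semialgebraic_ext => x /=; split=> h y //.
by have := h (const_mx y); rewrite mxE.
Qed.

End PolynomialMaps.

(** Recognises polynomial expressions in the coordinates of blocks of a row vector; the
matching is syntactic because unification would unfold [meval] into a sum. *)
Ltac polymap :=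
  repeat match goal with
  | |- polyfun (fun _ => meval _ _) => apply: polyfun_meval
  | |- polyfun (fun _ => sqlen _) => apply: polyfun_sqlen
  | |- polyfun (@sqlen _ _) => apply: (polyfun_sqlen (@polymap_id _ _))
  | |- polyfun (fun _ => \sum_(_ <- _ | _) _) => apply: polyfun_sum => ?
  | |- polyfun (fun _ => _ - _) => apply: polyfunB
  | |- polyfun (fun _ => _ + _) => apply: polyfunD
  | |- polyfun (fun _ => _ * _) => apply: polyfunM
  | |- polyfun (fun _ => _ ^+ _) => apply: polyfunX
  | |- polyfun (fun _ => fun_of_matrix _ _ _) => apply: polyfun_coord
  | |- polyfun _ => apply: polyfunC
  | |- polymap (fun x => x) => apply: polymap_id
  | |- polymap (@lsubmx _ _ _ _) => apply: (polymap_lsubmx (@polymap_id _ _))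
  | |- polymap (@rsubmx _ _ _ _) => apply: (polymap_rsubmx (@polymap_id _ _))
  | |- polymap (fun _ => lsubmx _) => apply: polymap_lsubmx
  | |- polymap (fun _ => rsubmx _) => apply: polymap_rsubmx
  | |- polymap (fun _ => row_mx _ _) => apply: polymap_row_mx
  | |- polymap (fun _ => _ - _) => apply: polymapB
  | |- polymap (fun _ => const_mx _) => apply: polymap_const
  | |- polymap _ => first [assumption | apply: polymap_comp]
  end.

(** * Growth of semialgebraic sets in the plane *)

Section Growth.
Variable R : realType.

Lemma horner_growth (p : {poly R}) : exists C N, 0 <= C /\ forall r : R, 1 <= r -> `|p.[r]| <= C * r ^+ N.
Proof.
exists (\sum_(i < size p) `|p`_i|), (size p); split; first exact: sumr_ge0.
move=> r r1; rewrite horner_coef (le_trans (ler_norm_sum _ _ _)) // mulr_suml.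
apply: ler_sum => i _; rewrite normrM ler_wpM2l // normrX.
by rewrite ger0_norm ?(le_trans ler01) // ler_weXn2l // ltnW.
Qed.

Lemma horner_away_from_0 (p : {poly R}) : p != 0 ->
  exists (r0 c : R), 0 < c /\ forall r, r0 <= r -> c <= `|p.[r]|.
Proof.
move=> p0.
wlog lp : p p0 / 0 < lead_coef p => [hw|].
  have : lead_coef p != 0 by rewrite lead_coef_eq0.
  rewrite neq_lt => /orP[lt|gt]; last exact: hw.
  have [||r0 [c [c0 h]]] := hw (- p); rewrite ?oppr_eq0 ?lead_coefN ?oppr_gt0 //.
  by exists r0, c; split=> // r /h; rewrite hornerN normrN.
have [r0 h] := poly_pinfty_gt_lc lp.
by exists r0, (lead_coef p); split=> // r /h /le_trans; apply; exact: ler_norm.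
Qed.

(** With the first variable fixed, a polynomial in two variables is a polynomial [Q] in
the second one, whose coefficients are polynomials in the first. *)
Lemma mpoly2_slice (p : mpoly (1 + 1) R) : exists Q : {poly {poly R}},
  forall r t : R, meval (row_mx (const_mx r : 'rV_1) (const_mx t : 'rV_1) 0) p
                  = (map_poly (horner_eval r) Q).[t].
Proof.
elim/mpolyind: p => [|c m p _ _ [Q eQ]].
  by exists 0 => r t; rewrite meval0 rmorph0 horner0.
exists ((c *: 'X^(m (lshift 1 0))) *: 'X^(m (rshift 1 0)) + Q) => r t.
rewrite mevalD mevalZ mevalX eQ rmorphD hornerD /= big_split_ord /= !big_ord1.
rewrite row_mxEl row_mxEr !mxE map_polyZ /= hornerZ map_polyXn hornerXn.
by rewrite /horner_eval hornerZ hornerXn mulrA.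
Qed.

(** The sign in the second variable is constant past the Cauchy bound of the roots.  This
bound grows at most like a power of the first variable, because the leading coefficient
stays away from [0]. *)
Lemma mpoly2_sign_stable (p : mpoly (1 + 1) R) :
  exists C N r0, 0 <= C /\ forall r, r0 <= r -> forall t u, C * r ^+ N <= t -> C * r ^+ N <= u ->
    Num.sg (meval (row_mx (const_mx r : 'rV_1) (const_mx t : 'rV_1) 0) p) =
    Num.sg (meval (row_mx (const_mx r : 'rV_1) (const_mx u : 'rV_1) 0) p).
Proof.
have [Q eQ] := mpoly2_slice p.
have [Q0|Q0] := eqVneq Q 0.
  by exists 0, 0%N, 0; split=> // r _ t u _ _; rewrite !eQ Q0 rmorph0 !horner0.
have [r0 [c [c0 cr]]] : exists (r0 c : R), 0 < c /\ forall r, r0 <= r -> c <= `|(lead_coef Q).[r]|.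
  by apply: horner_away_from_0; rewrite lead_coef_eq0.
have [C [N [C0 hC]]] : exists C N, 0 <= C /\ forall r : R, 1 <= r ->
    \sum_(i < size Q) `|(Q`_i).[r]| <= C * r ^+ N.
  elim: (size Q) => [|k [C [N [C0 hC]]]].
    by exists 0, 0%N; split=> // r _; rewrite big_ord0 mul0r.
  have [C' [N' [C'0 hC']]] := horner_growth (Q`_k).
  exists (C + C'), (maxn N N'); split=> [|r r1]; first exact: addr_ge0.
  rewrite big_ord_recr /= mulrDl lerD // ?(le_trans (hC _ r1)) ?(le_trans (hC' _ r1)) //.
    by rewrite ler_wpM2l // ler_weXn2l // leq_maxl.
  by rewrite ler_wpM2l // ler_weXn2l // leq_maxr.
exists (1 + c^-1 * C), N, (Num.max r0 1); split.
  by rewrite addr_ge0 // mulr_ge0 // invr_ge0 ltW.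
move=> r; rewrite ge_max => /andP[r0r r1] t u.
set q := map_poly (horner_eval r) Q.
have lc : lead_coef q = (lead_coef Q).[r].
  rewrite lead_coef_map_eq //; rewrite /horner_eval -normr_gt0.
  exact: lt_le_trans c0 (cr _ r0r).
have q0 : q != 0.
  by rewrite -lead_coef_eq0 lc -normr_gt0; exact: lt_le_trans c0 (cr _ r0r).
have szq : size q = size Q.
  by rewrite size_map_poly_id0 // /horner_eval -normr_gt0; exact: lt_le_trans c0 (cr _ r0r).
have le_bound : cauchy_bound q <= (1 + c^-1 * C) * r ^+ N.
  rewrite mulrDl mul1r; apply: lerD; first exact: exprn_ege1.
  rewrite -mulrA lc szq; apply: ler_pM => //.
  - exact: sumr_ge0.
  - by rewrite lef_pV2 ?posrE ?cr //; exact: lt_le_trans c0 (cr _ r0r).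
  - apply: le_trans (hC _ r1); rewrite le_eqVlt; apply/orP; left; apply/eqP.
    by apply: eq_bigr => i _; rewrite coef_map.
move=> le_t le_u; rewrite !eQ -/q.
have P := sgp_pinftyP (ge_cauchy_bound q0).
by rewrite !P // in_itv /= andbT; exact: le_trans le_bound _.
Qed.

(** Past the roots of the finitely many polynomials describing the set, a vertical slice
contains all points or none; being bounded above, it contains none.  And the roots grow
at most like a power of the abscissa. *)
Lemma semialgebraic_growth (S : set 'rV[R]_(1 + 1)) : semialgebraic S ->
  (forall r, exists B, forall t, S (row_mx (const_mx r) (const_mx t)) -> t <= B) ->
  exists C N r0, 0 <= C /\ forall r, r0 <= r -> forall t, S (row_mx (const_mx r) (const_mx t)) -> t <= C * r ^+ N.
Proof.
move=> [s Ss] Sb.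
have [C [N [r0 [C0 h]]]] : exists C N r0, 0 <= C /\ forall r, r0 <= r -> forall t u, C * r ^+ N <= t -> C * r ^+ N <= u ->
    forall p, p \in flatten [seq v.1 ++ v.2 | v <- s] ->
    Num.sg (meval (row_mx (const_mx r : 'rV_1) (const_mx t : 'rV_1) 0) p) =
    Num.sg (meval (row_mx (const_mx r : 'rV_1) (const_mx u : 'rV_1) 0) p).
  elim: (flatten _) => [|p l [C [N [r0 [C0 h]]]]]; first by exists 0, 0%N, 0.
  have [C' [N' [r0' [C'0 h']]]] := mpoly2_sign_stable p.
  exists (Num.max C C'), (maxn N N'), (Num.max 1 (Num.max r0 r0')); split.
    by rewrite le_max C0.
  move=> r; rewrite !ge_max => /and3P[r1 rr0 rr0'] t u ht hu q.
  have b1 : C * r ^+ N <= Num.max C C' * r ^+ maxn N N'.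
    apply: ler_pM => //; rewrite ?exprn_ge0 ?(le_trans ler01) ?le_max ?lexx //.
    by rewrite ler_weXn2l // leq_maxl.
  have b2 : C' * r ^+ N' <= Num.max C C' * r ^+ maxn N N'.
    apply: ler_pM => //; rewrite ?exprn_ge0 ?(le_trans ler01) ?le_max ?lexx ?orbT //.
    by rewrite ler_weXn2l // leq_maxr.
  rewrite inE => /orP[/eqP ->|]; first by apply: h' => //; [apply: le_trans b2 _|apply: le_trans b2 _].
  by apply: h => //; [apply: le_trans b1 _|apply: le_trans b1 _].
exists C, N, r0; split=> // r rr0 t St; rewrite leNgt; apply/negP => lt_t.
have [B hB] := Sb r; pose u := Num.max (B + 1) (C * r ^+ N).
suff /hB : S (row_mx (const_mx r) (const_mx u)).
  by rewrite /u ge_max leNgt ltrDl ltr01.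
move: St; rewrite Ss /= => /hasP[v vs /andP[v1 v2]]; apply/hasP; exists v => //.
have sgE p : p \in v.1 ++ v.2 -> Num.sg (meval (row_mx (const_mx r : 'rV_1) (const_mx t : 'rV_1) 0) p) =
    Num.sg (meval (row_mx (const_mx r : 'rV_1) (const_mx u : 'rV_1) 0) p).
  move=> pv; apply: h => //; first exact: ltW.
    by rewrite /u le_max lexx orbT.
  by apply/flattenP; exists (v.1 ++ v.2) => //; apply/mapP; exists v.
apply/andP; split; apply/allP => p pv.
  by rewrite -sgr_eq0 -sgE ?mem_cat ?pv // sgr_eq0; exact: (allP v1).
by rewrite -sgr_gt0 -sgE ?mem_cat ?pv ?orbT // sgr_gt0; exact: (allP v2).
Qed.

End Growth.

(** * Linear approximations of functions on a set *)

Section Curves.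
Variable R : realType.

(** The function [phi] minus the linear form [L] has derivative [0] along the curve, since the
curve moves at bounded speed. *)
Lemma derive_along_curve n (b : R -> 'rV[R]_n) (w L : 'rV[R]_n) (phi : R -> R) :
  derivable b (0 : R) 1 -> b^`()%classic 0 = w ->
  (forall e : R, 0 < e -> exists2 d : R, 0 < d & forall t, `|t| < d ->
     `|phi t - phi 0 - \sum_i (b t - b 0) 0 i * L 0 i| <= e * `|b t - b 0|) ->
  is_derive (0 : R) 1 phi (\sum_i w 0 i * L 0 i).
Proof.
move=> db bw h.
have dbi i : is_derive (0 : R) 1 (fun t => b t 0 i) (w 0 i).
  split; first by move/derivable_mxP: db.
  by rewrite -bw derive1E derive_mx // mxE.
have dL := is_derive_lincomb (index_enum 'I_n) (fun i => L 0 i) dbi.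
have dpsi : is_derive (0 : R) 1 (fun t => phi t - \sum_i L 0 i * b t 0 i) 0.
  apply: is_derive_cvg; apply/cvgrPdist_le => e e0.
  have w10 : 0 < `|w| + 1 by rewrite ltr_wpDl.
  have [d d0 dP] := h _ (divr_gt0 e0 w10).
  have qb : h^-1 *: (b (h *: 1 + 0) - b 0) @[h --> (0 : R)^'] --> w.
    by rewrite -bw derive1E; exact: db.
  near=> t.
  have t0 : t != 0 by near: t; exact: nbhs_dnbhs_neq.
  have td : `|t| < d by near: t; exact: dnbhs0_lt.
  have : `|w - t^-1 *: (b (t *: 1 + 0) - b 0)| <= 1.
    by near: t; move/cvgrPdist_le: qb; apply.
  rewrite -[t%:A]/(t * 1) mulr1 addr0 => qt.
  have bt : `|b t - b 0| <= (`|w| + 1) * `|t|.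
    have : `|t^-1 *: (b t - b 0)| <= `|w| + 1.
      rewrite -[t^-1 *: _](subKr w) (le_trans (ler_normB _ _)) // lerD2l.
      exact: qt.
    by rewrite normrZ normfV ler_pdivrMl ?normr_gt0 // mulrC.
  rewrite sub0r normrN normrZ normfV ler_pdivrMl ?normr_gt0 //.
  have -> : phi t - \sum_i L 0 i * b t 0 i - (phi 0 - \sum_i L 0 i * b 0 0 i) =
      phi t - phi 0 - \sum_i (b t - b 0) 0 i * L 0 i.
    have -> : \sum_i (b t - b 0) 0 i * L 0 i = \sum_i L 0 i * b t 0 i - \sum_i L 0 i * b 0 0 i.
      by rewrite -sumrB; apply: eq_bigr => i _; rewrite !mxE mulrBl !(mulrC (L 0 i)).
    by ring.
  apply: le_trans (dP t td) _; apply: le_trans (ler_wpM2l _ bt) _.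
    by rewrite ltW // divr_gt0.
  by rewrite mulrA divfK ?gt_eqF // mulrC.
have := is_deriveD dpsi dL; rewrite add0r.
have -> : (fun t => phi t - \sum_i L 0 i * b t 0 i) + (fun t => \sum_i L 0 i * b t 0 i) = phi.
  by apply/funext => t; rewrite -[LHS]/(_ - _ + _) subrK.
by congr (is_derive _ _ _ _); apply: eq_bigr => i _; rewrite mulrC.
Unshelve. all: end_near. Qed.

Variables (n : nat) (M : set 'rV[R]_n).

(** [L] is a gradient of [g] at [x] relative to [M].  Normal components of [L] are
not determined, which is why only its values on tangent vectors are compared. *)
Definition first_order_on (g : M -> R) (x : M) (L : 'rV[R]_n) : Prop :=
  forall e : R, 0 < e -> exists2 d : R, 0 < d & forall y : M, `|val y - val x| < d ->
    `|g y - g x - \sum_i (val y - val x) 0 i * L 0 i| <= e * `|val y - val x|.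

Lemma extension_first_order (g : M -> R) x U F : local_extension g x U F ->
  first_order_on g x (\row_i partial i F (val x)).
Proof.
move=> [oU Ux sF FE] e e0.
have [d1 d10 h1] := first_order_expansion oU Ux sF e0.
have [d2 d20 h2] := open_ball_sub oU Ux.
exists (Num.min d1 d2); first by rewrite lt_min d10.
move=> y; rewrite lt_min => /andP[yx1 yx2].
have := h1 _ yx1; rewrite (FE x Ux) (FE y (h2 _ yx2)).
rewrite (eq_bigr (fun i => (val y - val x) 0 i * (\row_i partial i F (val x)) 0 i)) // => i _.
by rewrite [X in _ = _ * X]mxE.
Qed.

(** Both sides compute the derivative of [g] along a curve in [M] with velocity [w]. *)
Lemma tangent_first_order (g : M -> R) x L L' w : tangent M (val x) w ->
  first_order_on g x L -> first_order_on g x L' ->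
  \sum_i w 0 i * L 0 i = \sum_i w 0 i * L' 0 i.
Proof.
move=> [J [b [[oJ J0] sb bM b0 b'0]]] gL gL'.
have db : derivable b (0 : R) 1 by exact: smooth_on_derivable sb J0.
have [d0 d00 d0P] := open_ball_sub oJ J0.
have cb := smooth_on_continuous sb J0.
pose phi (t : R) : R := if pselect (M (b t)) is left Mb then g (SigSub (mem_set Mb)) else 0.
have phiE (t : R) (m : M) : val m = b t -> phi t = g m.
  move=> e; rewrite /phi; case: pselect => [Mb|[]]; last by rewrite -e; exact: set_mem (valP m).
  by congr g; apply: val_inj; rewrite /= e.
have main K : first_order_on g x K -> is_derive (0 : R) 1 phi (\sum_i w 0 i * K 0 i).
  move=> gK; apply: derive_along_curve db b'0 _ => e e0.
  have [d1 d10 h1] := gK e e0.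
  have [d2 d20 h2] : exists2 d : R, 0 < d & forall t, `|t - 0| < d -> `|b t - b 0| < d1.
    have d120 : 0 < d1 / 2 by rewrite divr_gt0.
    have [d d'0 dP] := continuous_dist cb d120; exists d => // t /dP /le_lt_trans; apply.
    by rewrite ltr_pdivrMr // ltr_pMr // ltr1n.
  exists (Num.min d0 d2); first by rewrite lt_min d00.
  move=> t; rewrite lt_min => /andP[td0 td2].
  have Mbt : M (b t) by apply: bM; exists t => //; apply: d0P; rewrite subr0.
  pose y : M := SigSub (mem_set Mbt).
  have := h1 y; rewrite (phiE t y) // (phiE 0 x) // b0 => /(_ _) ->//.
  by rewrite -b0; apply: h2; rewrite subr0.
by have [_ <-] := main L gL; have [_ <-] := main L' gL'.
Qed.

(** Hence derivatives of functions on [M] in tangent directions are well defined. *)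
Lemma local_extension_derive (g : M -> R) (x : M) U F U' F' w : tangent M (val x) w ->
  local_extension g x U F -> local_extension g x U' F' -> 'D_w F (val x) = 'D_w F' (val x).
Proof.
move=> tw eF eF'; move: (eF) (eF') => [oU Ux sF _] [oU' Ux' sF' _].
rewrite (derive_partials w oU Ux sF) (derive_partials w oU' Ux' sF').
have := tangent_first_order tw (extension_first_order eF) (extension_first_order eF').
by under eq_bigr do rewrite mxE; under [in RHS]eq_bigr do rewrite mxE.
Qed.

End Curves.

(** * Nash functions *)

Section NashFunctions.
Variables (R : realType) (n : nat) (M : set 'rV[R]_n).
Implicit Types (g h : M -> R).

Definition graph_of g (x : 'rV[R]_n) (s : R) : Prop := exists2 m : M, val m = x & g m = s.

Lemma semialgebraic_graphP g :
  semialgebraic_map (fun x => const_mx (g x) : 'rV[R]_1) <->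
  semialgebraic [set z : 'rV[R]_(n + 1) | graph_of g (lsubmx z) (rsubmx z 0 0)].
Proof.
have E (z : 'rV[R]_(n + 1)) : [set row_mx (val x) (const_mx (g x)) | x in [set: M]] z <->
    graph_of g (lsubmx z) (rsubmx z 0 0).
  split=> [[m _ <-]|[m mx gm]]; first by exists m; rewrite ?row_mxKl ?row_mxKr ?mxE.
  exists m => //; rewrite mx gm -[RHS]hsubmxK; congr row_mx.
  by apply/rowP => i; rewrite mxE ord1.
by split; apply: semialgebraic_ext => z; have [? ?] := E z; split.
Qed.

Lemma semialgebraic_graph_at g m (T : 'rV[R]_m -> 'rV[R]_n) (s : 'rV[R]_m -> R) :
  semialgebraic_map (fun x => const_mx (g x) : 'rV[R]_1) -> polymap T -> polyfun s ->
  semialgebraic [set y | graph_of g (T y) (s y)].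
Proof.
move=> /semialgebraic_graphP sg pT ps.
have pU : polymap (fun y => row_mx (T y) (const_mx (s y) : 'rV[R]_1)) by polymap.
apply: semialgebraic_ext (semialgebraic_preimage pU sg) => y /=.
by rewrite row_mxKl row_mxKr mxE.
Qed.

Lemma graph_of_fun g (m : M) s : graph_of g (val m) s <-> g m = s.
Proof. by split=> [[m' /val_inj ->]|e] //; exists m. Qed.

Lemma smooth_restrict (W : normedModType R) (F : 'rV[R]_n -> W) :
  smooth_on setT F -> smooth (fun x : M => F (val x)).
Proof. by move=> sF x; exists setT, F; split=> //; exact: openT. Qed.

Lemma smoothM g h : smooth g -> smooth h -> smooth (fun x => g x * h x).
Proof.
move=> sg sh x; have [U [F [oU Ux sF FE]]] := sg x; have [V [G [oV Vx sG GE]]] := sh x.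
have oUV := openI oU oV; exists (U `&` V), (fun y => F y * G y); split=> //.
  by apply: smooth_onM => //; [apply: smooth_on_sub sF|apply: smooth_on_sub sG] => y [].
by move=> y [Uy Vy]; rewrite FE ?GE.
Qed.

Lemma nash_functionM g h : nash_function g -> nash_function h ->
  nash_function (fun x => g x * h x).
Proof.
move=> [sg ag] [sh ah]; split; first exact: smoothM.
apply/semialgebraic_graphP.
pose P (z : 'rV[R]_(n + 1)) s t := graph_of g (lsubmx z) s /\ graph_of h (lsubmx z) t /\
  rsubmx z 0 0 = s * t.
apply: (@semialgebraic_ext _ _ [set z | exists s t, P z s t]) => [z|].
  split=> [[s [t [[m mz <-] [+ zE]]]]|[m mz e]].
    by rewrite -mz => /graph_of_fun ht; exists m; rewrite // zE ht.
  by exists (g m), (h m); rewrite /P -mz -e; split; [|split] => //; exact/graph_of_fun.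
apply: semialgebraic_ex1; apply: semialgebraic_ex1.
apply: semialgebraicI; first by apply: semialgebraic_graph_at => //; polymap.
apply: semialgebraicI; first by apply: semialgebraic_graph_at => //; polymap.
by apply: semialgebraic_poly_eq; polymap.
Qed.

Lemma smooth_component (v : M -> 'rV[R]_n) i : smooth v -> smooth (fun x => v x 0 i).
Proof.
move=> sv x; have [U [F [oU Ux sF FE]]] := sv x.
exists U, (fun y => F y 0 i); split=> //; first by move/smooth_on_mxP: sF; exact.
by move=> y Uy; rewrite FE.
Qed.

Lemma nash_component_div (v : M -> 'rV[R]_n) i Q : smooth v -> semialgebraic_map v ->
  (forall x : M, meval (val x 0) Q != 0) -> nash_function (fun x => v x 0 i / meval (val x 0) Q).
Proof.
move=> sv av Q0; split.
  apply: smoothM; first exact: smooth_component.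
  move=> x; pose U := [set y : 'rV[R]_n | meval (y 0) Q != 0].
  have oU : open U.
    have -> : U = (fun y : 'rV[R]_n => meval (y 0) Q) @^-1` [set t | t != 0] by [].
    by apply: open_comp => [y _|]; [exact: continuous_meval|exact: open_neq].
  exists U, (fun y : 'rV[R]_n => (meval (y 0) Q)^-1); split=> //; first exact: Q0.
  by apply: smooth_onV => //; exact: smooth_on_meval.
apply/semialgebraic_graphP.
pose A := [set row_mx (val x) (v x) | x in [set: M]].
pose P (z : 'rV[R]_(n + 1)) (u : 'rV[R]_n) := A (row_mx (lsubmx z) u) /\
  u 0 i = rsubmx z 0 0 * meval (lsubmx z 0) Q.
apply: (@semialgebraic_ext _ _ [set z | exists u, P z u]) => [z|].
  split=> [[u [[m _ /eq_row_mx[mz mu]] e]]|[m mz e]].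
    by exists m => //; rewrite mu e -mz mulfK.
  exists (v m); split; first by rewrite -mz; exists m.
  by rewrite -e -mz divfK.
apply: semialgebraic_ex; apply: semialgebraicI.
  have pT : polymap (fun z : 'rV[R]_((n + 1) + n) => row_mx (lsubmx (lsubmx z)) (rsubmx z)) by polymap.
  exact: semialgebraic_preimage pT av.
by apply: semialgebraic_poly_eq; polymap.
Qed.

Definition directional (w : M -> 'rV[R]_n) g h : Prop :=
  forall x U F, local_extension g x U F -> h x = 'D_(w x) F (val x).

Lemma directional_exists (w : M -> 'rV[R]_n) g : (forall x : M, tangent M (val x) (w x)) -> smooth g ->
  exists h, directional w g h.
Proof.
move=> tw sg; have /choice[h hP] : forall x : M, exists s : R, forall U F,
    local_extension g x U F -> s = 'D_(w x) F (val x).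
  move=> x; have [U [F eF]] := sg x; exists ('D_(w x) F (val x)) => U' F' eF'.
  exact: local_extension_derive (tw x) eF eF'.
by exists h => x U F; exact: hP.
Qed.

Lemma polynomial_field_map (w : M -> 'rV[R]_n) : (forall i, polynomial_function (fun x : M => w x 0 i)) ->
  exists2 T : 'rV[R]_n -> 'rV[R]_n, polymap T & forall x, w x = T (val x).
Proof.
move=> /choice[p pw]; exists (fun y => \row_i meval (y 0) (p i)).
  by move=> i; exists (p i) => x; rewrite mxE.
by move=> x; apply/rowP => i; rewrite mxE pw.
Qed.

Lemma directional_smooth (w : M -> 'rV[R]_n) g h : (forall i, polynomial_function (fun x : M => w x 0 i)) ->
  smooth g -> directional w g h -> smooth h.
Proof.
move=> /choice[p pw] sg wh x; have [U [F eF]] := sg x; move: (eF) => [oU Ux sF FE].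
exists U, (fun y : 'rV[R]_n => \sum_i meval (y 0) (p i) * partial i F y); split=> //.
  apply: smooth_on_sum => // i; apply: smooth_onM => //; first exact: smooth_on_meval.
  exact: smooth_on_derive.
move=> y Uy; rewrite (wh y U F) ?(derive_partials _ oU Uy sF) //.
by apply: eq_bigr => i _; rewrite pw.
Qed.

Lemma norm_sq_le_sqlen (x : 'rV[R]_n) : `|x| ^+ 2 <= sqlen x.
Proof.
have h : `|x| <= Num.sqrt (sqlen x).
  apply: norm_row_le => [|i]; first exact: sqrtr_ge0.
  rewrite -sqrtr_sqr ler_sqrt ?sqlen_ge0 //.
  by rewrite /sqlen (bigD1 i) //= lerDl sumr_ge0 // => j _; exact: sqr_ge0.
by rewrite -[leRHS]sqr_sqrtr ?sqlen_ge0 // ler_sqr ?nnegrE ?sqrtr_ge0.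
Qed.

Lemma sqlen_le (x : 'rV[R]_n) : sqlen x <= n%:R * `|x| ^+ 2.
Proof.
rewrite mulr_natl -[X in _ *+ X]card_ord -sumr_const; apply: ler_sum => i _.
by rewrite -(real_normK (num_real (x 0 i))) ler_sqr ?nnegrE ?norm_coord_le.
Qed.

(** [first_order_on] spelled as a first order formula in the graph of [g], with squared
lengths instead of norms. *)
Definition first_order_graph g (x L : 'rV[R]_n) : Prop :=
  forall e : R, 0 < e -> exists d : R, 0 < d /\ forall (p : 'rV[R]_(n + 1)) (s : R),
    graph_of g x s -> graph_of g (lsubmx p) (rsubmx p 0 0) -> sqlen (lsubmx p - x) < d ->
    (rsubmx p 0 0 - s - \sum_i (lsubmx p - x) 0 i * L 0 i) ^+ 2 <= e * sqlen (lsubmx p - x).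

Lemma first_order_onP g (x : M) L : first_order_on g x L <-> first_order_graph g (val x) L.
Proof.
split=> [fo e e0|fo e e0].
  have [d d0 dP] := fo (Num.sqrt e) (ltac:(by rewrite sqrtr_gt0)).
  exists (d ^+ 2); split; first exact: exprn_gt0.
  move=> p s /graph_of_fun <- [y yp <-]; rewrite -yp => yd.
  have : `|val y - val x| < d.
    rewrite -ltr_sqr ?nnegrE ?(ltW d0) //.
    exact: le_lt_trans (norm_sq_le_sqlen _) yd.
  move=> /dP h; rewrite -ler_sqr ?nnegrE ?mulr_ge0 ?sqrtr_ge0 // in h.
  rewrite real_normK ?num_real // exprMn sqr_sqrtr ?(ltW e0) // in h.
  by apply: le_trans h _; rewrite ler_wpM2l ?(ltW e0) ?norm_sq_le_sqlen.
have n0 : 0 < n.+1%:R :> R by [].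
have e1 : 0 < e ^+ 2 / n.+1%:R by rewrite divr_gt0 // exprn_gt0.
have [d [d0 dP]] := fo _ e1.
exists (Num.sqrt (d / n.+1%:R)); first by rewrite sqrtr_gt0 divr_gt0.
move=> y yx.
have := dP (row_mx (val y) (const_mx (g y))) (g x); rewrite !row_mxKl !row_mxKr mxE.
have hn : n%:R / n.+1%:R <= 1 :> R by rewrite ler_pdivrMr // mul1r ler_nat.
have sq : sqlen (val y - val x) < d.
  apply: le_lt_trans (sqlen_le _) _.
  have h : `|val y - val x| ^+ 2 < d / n.+1%:R.
    rewrite -[ltRHS]sqr_sqrtr; last by rewrite ltW // divr_gt0.
    by rewrite ltr_sqr ?nnegrE ?sqrtr_ge0.
  apply: (@le_lt_trans _ _ (n.+1%:R * `|val y - val x| ^+ 2)).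
    by rewrite ler_wpM2r ?sqr_ge0 // ler_nat.
  by rewrite mulrC -ltr_pdivlMr.
move=> /(_ ((graph_of_fun g x _).2 erefl) ((graph_of_fun g y _).2 erefl) sq) h.
rewrite -ler_sqr ?nnegrE ?mulr_ge0 ?(ltW e0) // real_normK ?num_real //.
apply: le_trans h _; rewrite exprMn -mulrA ler_wpM2l ?sqr_ge0 //.
rewrite ler_pdivrMl //; apply: le_trans (sqlen_le _) _.
by rewrite ler_wpM2r ?sqr_ge0 // ler_nat.
Qed.

(** The derivative along a tangent vector is read off any linear approximation of [g], and
the existence of a linear approximation with a given value is a first order formula in
the graph of [g]; quantifier elimination makes the graph of [h] semialgebraic. *)
Lemma directional_nash (w : M -> 'rV[R]_n) g h : semialgebraic M -> (forall x : M, tangent M (val x) (w x)) ->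
  (forall i, polynomial_function (fun x : M => w x 0 i)) ->
  nash_function g -> directional w g h -> nash_function h.
Proof.
move=> aM tw pw [sg ag] wh; split; first exact: directional_smooth wh.
have [T pT wT] := polynomial_field_map pw.
apply/semialgebraic_graphP.
pose A := [set z : 'rV[R]_(n + 1) | M (lsubmx z) /\
    exists L : 'rV[R]_n, rsubmx z 0 0 = \sum_i T (lsubmx z) 0 i * L 0 i /\
      first_order_graph g (lsubmx z) L].
have sA : semialgebraic A.
  apply: semialgebraicI.
    by apply: semialgebraic_preimage aM; polymap.
  apply: semialgebraic_ex; apply: semialgebraicI.
    by apply: semialgebraic_poly_eq; polymap.
  apply: semialgebraic_all1; apply: semialgebraic_imp.
    by apply: semialgebraic_poly_lt; polymap.
  apply: semialgebraic_ex1; apply: semialgebraicI.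
    by apply: semialgebraic_poly_lt; polymap.
  apply: semialgebraic_all; apply: semialgebraic_all1.
  apply: semialgebraic_imp; first by apply: semialgebraic_graph_at => //; polymap.
  apply: semialgebraic_imp; first by apply: semialgebraic_graph_at => //; polymap.
  apply: semialgebraic_imp; first by apply: semialgebraic_poly_lt; polymap.
  by apply: semialgebraic_poly_le; polymap.
apply: semialgebraic_ext sA => z.
have hE (x : M) : exists2 L, first_order_on g x L & h x = \sum_i T (val x) 0 i * L 0 i.
  have [U [F eF]] := sg x; move: (eF) => [oU Ux sF _].
  exists (\row_i partial i F (val x)); first exact: extension_first_order eF.
  rewrite (wh x U F eF) (derive_partials _ oU Ux sF).
  by apply: eq_bigr => i _; rewrite wT [in RHS]mxE.
split=> [[Mz [L [zL gL]]]|[x xz hx]].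
  pose x : M := SigSub (mem_set Mz); exists x => //; rewrite zL.
  have [L' fo ->] := hE x; rewrite -[lsubmx z]/(val x) -wT.
  apply: tangent_first_order (tw x) fo _; exact/first_order_onP.
rewrite /A /= -hx -xz; split; first exact: set_mem (valP x).
by have [L fo hL] := hE x; exists L; split=> //; apply/first_order_onP.
Qed.

End NashFunctions.

(** * Polynomial bounds for Nash functions *)

Section NashGrowth.
Variables (R : realType) (n : nat).

Lemma continuous_polyfun m (f : 'rV[R]_m -> R) : polyfun f -> continuous f.
Proof.
move=> [p fp]; rewrite (_ : f = fun x => meval (x 0) p); last exact/funext.
exact: continuous_meval.
Qed.

Lemma closed_zero_locus k (f : 'I_k -> mpoly n R) : closed (zero_locus f).
Proof.
have -> : zero_locus f = \bigcap_(j in [set: 'I_k]) ((fun x : 'rV[R]_n => meval (x 0) (f j)) @^-1` [set 0]).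
  by apply/seteqP; split=> x /= h j => [_|]; apply: h.
apply: closed_bigI => j _; apply: closed_comp => [x _|]; first exact: continuous_meval.
exact: closed_eq.
Qed.

Variable M : set 'rV[R]_n.
Hypothesis closedM : closed M.

Lemma smooth_bounded_on_balls (g : M -> R) (r : R) : smooth g ->
  exists B : R, forall x : M, sqlen (val x) <= r -> g x ^+ 2 <= B.
Proof.
move=> sg; pose A := M `&` [set y : 'rV[R]_n | sqlen y <= r].
have cA : compact A.
  apply: bounded_closed_compact.
    exists (1 + r); split; first exact: num_real.
    move=> B rB y [_ yr]; apply: le_trans (ltW rB).
    have y2 := le_trans (norm_sq_le_sqlen y) yr.
    have := sqr_ge0 (`|y| - 1); have := normr_ge0 y; nra.
  apply: closedI => //.
  have -> : [set y : 'rV[R]_n | sqlen y <= r] = (@sqlen R n) @^-1` [set t | t <= r] by [].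
  apply: closed_comp; last exact: closed_le.
  by move=> y _; apply: continuous_polyfun; apply: polyfun_sqlen; exact: polymap_id.
have [[x0 Ax0]|nA] := pselect (A !=set0); last first.
  by exists 0 => x xr; case: nA; exists (val x); split=> //; exact: set_mem (valP x).
pose G (y : 'rV[R]_n) : R := if pselect (M y) is left My then g (SigSub (mem_set My)) ^+ 2 else 0.
have GE (x : M) : G (val x) = g x ^+ 2.
  rewrite /G; case: pselect => [My|[]]; last exact: set_mem (valP x).
  by congr (g _ ^+ 2); exact: val_inj.
have cG : {within A, continuous G}.
  apply/subspace_continuousP => y [My yr].
  pose x : M := SigSub (mem_set My).
  have [U [F [oU Ux sF FE]]] := sg x.
  have cF : F z ^+ 2 @[z --> y] --> F y ^+ 2.
    apply: (@continuous_comp _ _ _ F (fun t => t ^+ 2)); last exact: exprn_continuous.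
    exact: smooth_on_continuous sF Ux.
  have GF (z : 'rV[R]_n) (Mz : M z) : U z -> G z = F z ^+ 2.
    move=> Uz; pose m : M := SigSub (mem_set Mz).
    by have e : G z = g m ^+ 2 := GE m; rewrite e -(FE m Uz).
  rewrite /from_subspace (GF y My Ux); have cFA : F z ^+ 2 @[z --> within A (nbhs y)] --> F y ^+ 2 by exact: cvg_within_filter.
  have FG : {near within A (nbhs y), (fun z => F z ^+ 2) =1 G}.
    rewrite near_withinE; near=> z => -[Mz _].
    by rewrite (GF z Mz) //; near: z; exact: open_nbhs_nbhs.
  exact: cvg_trans (near_eq_cvg FG) cFA.
have [y yA ymax] := EVT_max_rV (ex_intro _ x0 Ax0) cA cG.
exists (G y) => x xr; rewrite -GE; apply: ymax; rewrite inE; split=> //.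
exact: set_mem (valP x).
Unshelve. all: end_near. Qed.

(** The points below the square of the function on balls of growing radius form a
semialgebraic subset of the plane.  Its slices are bounded, since a smooth function is
bounded on the compact intersections of [M] with balls, so that [semialgebraic_growth]
applies. *)
Lemma nash_function_poly_bound (g : M -> R) : nash_function g ->
  exists p : mpoly n R, forall x : M, `|g x| <= meval (val x 0) p.
Proof.
move=> [sg ag].
(* [z] consists of the squared radius and the height, [q] of a point and its value *)
pose P (z : 'rV[R]_(1 + 1)) (q : 'rV[R]_(n + 1)) := graph_of g (lsubmx q) (rsubmx q 0 0) /\
  sqlen (lsubmx q) <= lsubmx z 0 0 /\ rsubmx z 0 0 <= rsubmx q 0 0 ^+ 2.
pose S := [set z | exists q, P z q].
have SE r t : S (row_mx (const_mx r) (const_mx t)) <->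
    exists x : M, sqlen (val x) <= r /\ t <= g x ^+ 2.
  split=> [[q [[x xq gx] [h1 h2]]]|[x [h1 h2]]].
    by exists x; move: h1 h2; rewrite -xq -gx row_mxKl row_mxKr !mxE.
  exists (row_mx (val x) (const_mx (g x))).
  by rewrite /P !row_mxKl !row_mxKr !mxE; split=> //; exists x.
have sS : semialgebraic S.
  apply: semialgebraic_ex; apply: semialgebraicI.
    by apply: semialgebraic_graph_at => //; polymap.
  by apply: semialgebraicI; apply: semialgebraic_poly_le; polymap.
have bS r : exists B, forall t, S (row_mx (const_mx r) (const_mx t)) -> t <= B.
  have [B hB] := smooth_bounded_on_balls r sg; exists B => t /SE[x [xr /le_trans]]; apply.
  exact: hB.
have [C [N [r0 [C0 h]]]] := semialgebraic_growth sS bS.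
have [B hB] := smooth_bounded_on_balls r0 sg.
have [p pE] : polyfun (fun y : 'rV[R]_n => 1 + `|B| + C * sqlen y ^+ N).
  by polymap.
exists p => x; rewrite -pE.
have gx2 : g x ^+ 2 <= `|B| + C * sqlen (val x) ^+ N.
  have CN0 : 0 <= C * sqlen (val x) ^+ N by rewrite mulr_ge0 // exprn_ge0 // sqlen_ge0.
  have [le|lt] := leP r0 (sqlen (val x)).
    by rewrite ler_wpDl //; apply: (h _ le); apply/SE; exists x.
  by rewrite ler_wpDr // (le_trans (hB _ (ltW lt))) // ler_norm.
rewrite -addrA; apply: (@le_trans _ _ (1 + g x ^+ 2)); last by rewrite lerD2l.
rewrite -(real_normK (num_real (g x))); have := sqr_ge0 (`|g x| - 1); nra.
Qed.

End NashGrowth.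

(** * Differential operators with Nash coefficients *)

Section Operators.
Variables (R : realType) (n : nat) (M : set 'rV[R]_n).
Local Notation op := (Cinf M -> Cinf M).
Implicit Types (phi psi : Cinf M) (D : op).

(** Smoothness proofs are irrelevant, so composing operators respects pointwise equality. *)
Lemma Cinf_ext phi psi : (forall x, phi x = psi x) -> phi = psi.
Proof.
move: phi psi => [f sf] [g sg] /= /funext fg; subst g.
by congr MkCinf; exact: Prop_irrelevance.
Qed.

Lemma smoothD (g h : M -> R) : smooth g -> smooth h -> smooth (fun x => g x + h x).
Proof.
move=> sg sh x; have [U [F [oU Ux sF FE]]] := sg x; have [V [G [oV Vx sG GE]]] := sh x.
have oUV := openI oU oV; exists (U `&` V), (fun y => F y + G y); split=> //.
  by apply: smooth_onD => //; [apply: smooth_on_sub sF|apply: smooth_on_sub sG] => y [].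
by move=> y [Uy Vy]; rewrite FE ?GE.
Qed.

Lemma smooth_cst (c : R) : smooth (fun _ : M => c).
Proof. exact: (smooth_restrict (smooth_on_cst c openT)). Qed.

Definition mulC (g : M -> R) (sg : smooth g) : op :=
  fun phi => MkCinf (smoothM sg (Cinf_smooth phi)).

Definition addC phi psi : Cinf M := MkCinf (smoothD (Cinf_smooth phi) (Cinf_smooth psi)).

Lemma derivationD (v : M -> 'rV[R]_n) D phi psi : derivation_along v D ->
  forall x, D (addC phi psi) x = D phi x + D psi x.
Proof.
move=> vD x; have [U [F eF]] := Cinf_smooth phi x; have [V [G eG]] := Cinf_smooth psi x.
rewrite (vD _ _ _ _ eF) (vD _ _ _ _ eG).
move: eF eG => [oU Ux sF FE] [oV Vx sG GE]; have oUV := openI oU oV.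
rewrite (vD _ x (U `&` V) (fun y => F y + G y)).
  by rewrite (deriveD (smooth_on_derivable sF Ux) (smooth_on_derivable sG Vx)).
split=> //; last by move=> y [Uy Vy]; rewrite FE ?GE.
by apply: smooth_onD => //; [apply: smooth_on_sub sF|apply: smooth_on_sub sG] => y [].
Qed.

Lemma derivationM (v : M -> 'rV[R]_n) D phi psi (sphi : smooth phi) : derivation_along v D ->
  forall x, D (mulC sphi psi) x = D phi x * psi x + phi x * D psi x.
Proof.
move=> vD x; have [U [F eF]] := Cinf_smooth phi x; have [V [G eG]] := Cinf_smooth psi x.
rewrite (vD _ _ _ _ eF) (vD _ _ _ _ eG).
move: eF eG => [oU Ux sF FE] [oV Vx sG GE]; have oUV := openI oU oV.
rewrite (vD _ x (U `&` V) (fun y => F y * G y)).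
  rewrite (deriveM (smooth_on_derivable sF Ux) (smooth_on_derivable sG Vx)).
  by rewrite FE // GE // addrC -![_ *: _]/(_ * _) (mulrC (psi x)).
split=> //; last by move=> y [Uy Vy]; rewrite FE ?GE.
by apply: smooth_onM => //; [apply: smooth_on_sub sF|apply: smooth_on_sub sG] => y [].
Qed.

Lemma derivation_exists (w : M -> 'rV[R]_n) : algebraic_vector_field w ->
  exists D, derivation_along w D.
Proof.
move=> [pw tw]; have /choice[D DP] : forall phi, exists psi : Cinf M, directional w phi psi.
  move=> phi; have [h hP] := directional_exists tw (Cinf_smooth phi).
  by exists (MkCinf (directional_smooth pw (Cinf_smooth phi) hP)).
by exists D => phi x U F; exact: DP.
Qed.

Lemma algebraic_diffopD D : algebraic_diffop D ->
  forall phi psi x, D (addC phi psi) x = D phi x + D psi x.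
Proof.
elim=> {D} [D [[g _ gD]|[v _ vD]]||D1 D2 D _ IH1 _ IH2 DE|a D1 D _ IH DE|D1 D2 _ IH1 _ IH2] phi psi x.
- by rewrite !gD mulrDr.
- exact: derivationD vD x.
- by [].
- by rewrite !DE IH1 IH2 addrACA.
- by rewrite !DE IH mulrDr.
- rewrite /comp (_ : D2 (addC phi psi) = addC (D2 phi) (D2 psi)) ?IH1 //.
  by apply: Cinf_ext => y; rewrite IH2.
Qed.

Lemma algebraic_diffop_eq0 D phi : algebraic_diffop D -> (forall x, phi x = 0) ->
  forall x, D phi x = 0.
Proof.
move=> aD phi0 x; have := algebraic_diffopD aD phi phi x.
rewrite (_ : addC phi phi = phi); last by apply: Cinf_ext => y; rewrite /= phi0 addr0.
by move=> /eqP; rewrite -subr_eq subrr => /eqP.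
Qed.

Lemma generated_algebra_sub (G G' : set op) D : G `<=` G' ->
  generated_algebra G D -> generated_algebra G' D.
Proof.
move=> GG'; elim=> {D} [D /GG'||D1 D2 D _ h1 _ h2 DE|a D1 D _ h DE|D1 D2 _ h1 _ h2].
- exact: gen_base.
- exact: gen_one.
- exact: gen_add h1 h2 DE.
- exact: gen_scale h DE.
- exact: gen_comp.
Qed.

Lemma bounded_funP (h : M -> R) : bounded_fun h <-> exists B, forall x, `|h x| <= B.
Proof.
split=> [[B [_ hB]]|[B hB]].
  by exists (B + 1) => x; apply: hB => //; rewrite ltrDl.
exists B; split; first exact: num_real.
by move=> B' BB' x _; apply: le_trans (hB x) (ltW BB').
Qed.

Section NashCombinations.
Hypothesis aM : semialgebraic M.

(** Combinations of algebraic differential operators with Nash coefficients on the left,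
as maps from smooth functions to plain functions. *)
Inductive nash_combination : (Cinf M -> M -> R) -> Prop :=
| comb0 : nash_combination (fun _ _ => 0)
| comb_cons (a : M -> R) D E : nash_function a -> algebraic_diffop D -> nash_combination E ->
    nash_combination (fun phi x => a x * D phi x + E phi x).

Lemma comb_ext E E' : (forall phi x, E phi x = E' phi x) -> nash_combination E -> nash_combination E'.
Proof.
by move=> EE'; have -> : E' = E by apply/funext => phi; apply/funext => x; rewrite EE'.
Qed.

Lemma comb1 a D : nash_function a -> algebraic_diffop D ->
  nash_combination (fun phi x => a x * D phi x).
Proof. by move=> na aD; apply: comb_ext (comb_cons na aD comb0) => phi x; rewrite addr0. Qed.

Lemma combD E E' : nash_combination E -> nash_combination E' ->
  nash_combination (fun phi x => E phi x + E' phi x).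
Proof.
move=> cE cE'; elim: cE => [|a D E0 na aD _ IH]; first by apply: comb_ext cE' => phi x; rewrite add0r.
by apply: comb_ext (comb_cons na aD IH) => phi x; rewrite addrA.
Qed.

Lemma comb_sum I (r : seq I) (E : I -> Cinf M -> M -> R) : (forall i, nash_combination (E i)) ->
  nash_combination (fun phi x => \sum_(i <- r) E i phi x).
Proof.
move=> cE; elim: r => [|i r IH]; first by apply: comb_ext comb0 => phi x; rewrite big_nil.
by apply: comb_ext (combD (cE i) IH) => phi x; rewrite big_cons.
Qed.

Lemma combM a E : nash_function a -> nash_combination E ->
  nash_combination (fun phi x => a x * E phi x).
Proof.
move=> na; elim=> [|b D E0 nb aD _ IH]; first by apply: comb_ext comb0 => phi x; rewrite mulr0.
by apply: comb_ext (comb_cons (nash_functionM na nb) aD IH) => phi x; rewrite mulrDr mulrA.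
Qed.

Lemma comb_smooth E phi : nash_combination E -> smooth (E phi).
Proof.
elim=> [|a D E0 [sa _] _ _ IH]; first exact: smooth_cst.
by apply: smoothD IH; apply: smoothM => //; exact: Cinf_smooth.
Qed.

Lemma comb_comp_algebraic E D : nash_combination E -> algebraic_diffop D ->
  nash_combination (fun phi => E (D phi)).
Proof.
move=> cE aD; elim: cE => [|a D' E0 na aD' _ IH]; first exact: comb0.
exact: comb_cons na (gen_comp aD' aD) IH.
Qed.

Lemma nash_function_cst c : nash_function (fun _ : M => c).
Proof.
split; first exact: smooth_cst.
apply/semialgebraic_graphP.
apply: (@semialgebraic_ext _ _ [set z : 'rV[R]_(n + 1) | M (lsubmx z) /\ rsubmx z 0 0 = c]) => [z|].
  split=> /= [[Mz ->]|[x <- ->]]; last by split=> //; exact: set_mem (valP x).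
  by exists (SigSub (mem_set Mz)).
apply: semialgebraicI; first by apply: semialgebraic_preimage aM; polymap.
by apply: semialgebraic_poly_eq; polymap.
Qed.

(** [D] can be moved to the right of a coefficient.  For a composite of two operators this
requires [comb_after_algebraic], whose proof in turn moves the first one past the
coefficients of the second; the property is therefore named and proved by induction. *)
Definition commutes_past_nash D := forall (b : M -> R) (sb : smooth b), nash_function b ->
  nash_combination (fun phi => D (mulC sb phi)).

(** [D'] is the operator underlying the combination [E]: [D] applies to smooth functions
only, so that [E] has to be lifted before [D] is composed with it. *)
Lemma comb_after_algebraic D (D' : op) E : algebraic_diffop D -> commutes_past_nash D ->
  nash_combination E -> (forall phi x, D' phi x = E phi x) -> nash_combination (fun phi => D (D' phi)).
Proof.
move=> aD cD cE; elim: cE D' => [|a W E0 na aW cE0 IH] D' D'E.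
  by apply: comb_ext comb0 => phi x; rewrite algebraic_diffop_eq0.
pose D0 : op := fun phi => MkCinf (comb_smooth phi cE0).
have sa : smooth a by case: na.
have c1 := comb_comp_algebraic (cD a sa na) aW.
apply: comb_ext (combD c1 (IH D0 (fun _ _ => erefl))) => phi x.
rewrite -algebraic_diffopD //; congr (Cinf_fun (D _) x).
by apply: Cinf_ext => y; rewrite D'E.
Qed.

(** For a derivation this is Leibniz' rule, and it is here that the derivatives of Nash
functions have to be Nash. *)
Lemma algebraic_commutes_past_nash D : algebraic_diffop D -> commutes_past_nash D.
Proof.
move=> aD; have := aD; elim=> {D aD} [D GD|| D1 D2 D a1 IH1 a2 IH2 DE|a D1 D a1 IH DE|D1 D2 a1 IH1 a2 IH2] b sb nb.
- have aD : algebraic_diffop D by exact: gen_base.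
  case: GD => [[g _ gD]|[w [pw tw] wD]].
    by apply: comb_ext (comb1 nb aD) => phi x; rewrite !gD mulrCA.
  have ndb : nash_function (D (MkCinf sb)).
    apply: (directional_nash aM tw pw nb) => x U F eF.
    exact: (wD (MkCinf sb) x U F eF).
  apply: comb_ext (combD (comb1 ndb (gen_one _)) (comb1 nb aD)) => phi x.
  by rewrite (derivationM (phi := MkCinf sb) phi sb wD).
- by apply: comb_ext (comb1 nb (gen_one _)) => phi x.
- by apply: comb_ext (combD (IH1 b sb nb) (IH2 b sb nb)) => phi x; rewrite DE.
- by apply: comb_ext (combM (nash_function_cst a) (IH b sb nb)) => phi x; rewrite DE.
- exact: (comb_after_algebraic a1 IH1 (IH2 b sb nb) (fun _ _ => erefl)).
Qed.

Lemma comb_comp E D : nash_combination E -> nash_combination (fun phi => D phi) ->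
  nash_combination (fun phi => E (D phi)).
Proof.
move=> cE cD; elim: cE => [|a W E0 na aW _ IH]; first exact: comb0.
apply: combD IH; apply: combM => //.
exact: (comb_after_algebraic aW (algebraic_commutes_past_nash aW) cD (fun _ _ => erefl)).
Qed.

(** The hypothesis reduces the claim to Nash derivations; on a smooth variety it is
[nash_derivation_combination]. *)
Lemma nash_diffop_combination :
  (forall v D, nash_vector_field v -> derivation_along v D -> nash_combination (fun phi => D phi)) ->
  forall D, nash_diffop D -> nash_combination (fun phi => D phi).
Proof.
move=> frame D; elim=> {D} [D [[g ng gD]|[v nv vD]]||D1 D2 D _ IH1 _ IH2 DE|a D1 D _ IH DE|D1 D2 _ IH1 _ IH2].
- by apply: comb_ext (comb1 ng (gen_one _)) => phi x; rewrite gD.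
- exact: frame nv vD.
- by apply: comb_ext (comb1 (nash_function_cst 1) (gen_one _)) => phi x; rewrite mul1r.
- by apply: comb_ext (combD IH1 IH2) => phi x; rewrite DE.
- by apply: comb_ext (combM (nash_function_cst a) IH) => phi x; rewrite DE.
- exact: comb_comp IH1 IH2.
Qed.

(** A Nash coefficient is at most a polynomial [p], and an algebraic operator followed by
the multiplication by [p] is again algebraic. *)
Lemma comb_bounded E phi : closed M -> nash_combination E ->
  (forall D, algebraic_diffop D -> bounded_fun (D phi)) -> bounded_fun (E phi).
Proof.
move=> cM cE bD; elim: cE => [|a D E0 na aD _ /bounded_funP[B0 hB0]].
  by apply/bounded_funP; exists 0 => x; rewrite normr0.
have [p hp] := nash_function_poly_bound cM na.
have sp : smooth (fun x : M => meval (val x 0) p).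
  exact: (smooth_restrict (smooth_on_meval p openT)).
have apD : algebraic_diffop (mulC sp \o D).
  apply: gen_comp => //; apply: gen_base; left; exists (fun x : M => meval (val x 0) p) => //.
  by exists p.
have /bounded_funP[B hB] := bD _ apD.
apply/bounded_funP; exists (B + B0) => x; apply: le_trans (ler_normD _ _) _.
rewrite lerD // (le_trans _ (hB x)) //= !normrM ler_wpM2r // (le_trans (hp x)) //.
exact: ler_norm.
Qed.

End NashCombinations.

Lemma algebraic_nash_diffop D : semialgebraic M -> algebraic_diffop D -> nash_diffop D.
Proof.
move=> aM; apply: generated_algebra_sub => {}D [[g [p gp] gD]|[w [pw tw] wD]].
  left; exists g => //; split.
    rewrite (_ : g = fun x : M => meval (val x 0) p); last exact/funext.
    exact: (smooth_restrict (smooth_on_meval p openT)).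
  apply/semialgebraic_graphP.
  apply: (@semialgebraic_ext _ _ [set z : 'rV[R]_(n + 1) | M (lsubmx z) /\ rsubmx z 0 0 = meval (lsubmx z 0) p]) => [z|].
    split=> /= [[Mz ->]|[x <- <-]]; last by split; [exact: set_mem (valP x)|exact: gp].
    by exists (SigSub (mem_set Mz)) => //; rewrite gp.
  apply: semialgebraicI; first by apply: semialgebraic_preimage aM; polymap.
  by apply: semialgebraic_poly_eq; polymap.
right; exists w => //; have [T pT wT] := polynomial_field_map pw; split=> //.
  rewrite (_ : w = fun x : M => T (val x)); last exact/funext.
  apply: smooth_restrict; apply/smooth_on_mxP => [|i j]; first exact: openT.
  have [p Tp] := pT j; rewrite ord1 (_ : (fun x => T x 0 j) = fun x => meval (x 0) p); last exact/funext.
  exact: smooth_on_meval openT.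
apply: (@semialgebraic_ext _ _ [set z : 'rV[R]_(n + n) | M (lsubmx z) /\
    forall i, rsubmx z 0 i = T (lsubmx z) 0 i]) => [z|].
  split=> [[Mz zT]|[x _ <-]].
    exists (SigSub (mem_set Mz)) => //; rewrite wT -[RHS]hsubmxK; congr row_mx.
    by apply/rowP => i; rewrite [RHS]zT.
  by rewrite /= row_mxKl row_mxKr; split=> [|i]; [exact: set_mem (valP x)|rewrite wT].
apply: semialgebraicI; first by apply: semialgebraic_preimage aM; polymap.
by apply: semialgebraic_forall => i; apply: semialgebraic_poly_eq; polymap.
Qed.

End Operators.

(** * Nash operators on a smooth variety *)

Section SmoothVarietyDiffops.
Variables (R : realType) (n k : nat) (f : 'I_k -> mpoly n R).
Local Notation M := (zero_locus f).

Lemma semialgebraic_zero_locus : semialgebraic M.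
Proof.
apply: (@semialgebraic_ext _ _ [set x | forall j, meval (x 0) (f j) = 0]) => //.
by apply: semialgebraic_forall => j; exact: semialgebraic_eq0.
Qed.

Hypothesis sm : smooth_variety f.

(** With the spanning matrix [W] and the positive polynomial [Q], a tangent field is
[v = sum_i (v_i / Q) W_i], where the rows [W_i] are algebraic fields. *)
Lemma nash_derivation_combination (v : M -> 'rV[R]_n) D : nash_vector_field v ->
  derivation_along v D -> nash_combination (fun phi => D phi).
Proof.
move=> [sv av tv] vD.
have [Q [W hW]] := spanning_tangent_matrix sm.
have Mval (x : M) : M (val x) := set_mem (valP x).
have Q0 (x : M) : meval (val x 0) Q != 0 by have [Q0 _ _] := hW _ (Mval x); rewrite gt_eqF.
pose w i (x : M) : 'rV[R]_n := row i (map_mx (meval (val x 0)) W).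
have aw i : algebraic_vector_field (w i).
  split=> [j|x]; last by have [_ tW _] := hW _ (Mval x); exact: tW.
  by exists (W i j) => x; rewrite !mxE.
have /choice[Dw wD] := fun i => derivation_exists (aw i).
have aDw i : algebraic_diffop (Dw i) by apply: gen_base; right; exists (w i).
have na i := nash_component_div i sv av Q0.
apply: comb_ext (comb_sum (index_enum 'I_n) (fun i => comb1 (na i) (aDw i))) => phi x.
have [U [F eF]] := Cinf_smooth phi x; move: (eF) => [oU Ux sF _].
rewrite (vD phi x U F eF) (derive_partials _ oU Ux sF).
have [_ _ /(_ _ (tv x)) vW] := hW _ (Mval x).
transitivity (\sum_i \sum_j (v x 0 i / meval (val x 0) Q) * (w i x 0 j * partial j F (val x))).
  apply: eq_bigr => i _; rewrite (wD i phi x U F eF) (derive_partials _ oU Ux sF).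
  by rewrite mulr_sumr.
rewrite exchange_big; apply: eq_bigr => j _ /=.
have -> : v x 0 j = (meval (val x 0) Q)^-1 * \sum_i v x 0 i * w i x 0 j.
  apply: (mulfI (Q0 x)); rewrite mulrA mulfV // mul1r.
  move/rowP/(_ j): vW; rewrite [LHS]mxE [RHS]mxE => <-.
  by apply: eq_bigr => i _; rewrite [w i x 0 j]mxE.
by rewrite mulr_sumr mulr_suml; apply: eq_bigr => i _; ring.
Qed.

Lemma schwartz_space_smooth_variety :
  schwartz_space M = [set phi | forall D, algebraic_diffop D -> bounded_fun (D phi)].
Proof.
have aM := semialgebraic_zero_locus.
apply/seteqP; split=> phi /= bD D hD.
  by apply: bD; exact: algebraic_nash_diffop.
have cD : nash_combination (fun psi => D psi).
  by apply: nash_diffop_combination hD => // v D' nv vD'; exact: nash_derivation_combination nv vD'.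
exact: comb_bounded (closed_zero_locus (f := f)) cD bD.
Qed.

End SmoothVarietyDiffops.

(** * Rapidly decreasing functions on R^n *)

Section ClassicalSchwartz.
Variables (R : realType) (n : nat).
Local Notation V := 'rV[R]_n.
Local Notation T := [set: 'rV[R]_n].

(** The affine space is the smooth variety without equations. *)
Lemma schwartz_space_full :
  schwartz_space T = [set phi | forall D, algebraic_diffop D -> bounded_fun (D phi)].
Proof.
pose f0 (i : 'I_0) : mpoly n R := 0.
have sm : smooth_variety f0.
  move=> x _; exists 0%N, (fun _ => 0), 1; split=> [[]//||| [] //].
    by rewrite /row_free; apply/eqP/esym/eqP; rewrite eq_sym -leqn0 rank_leq_row.
  by rewrite meval1 oner_neq0.
have TE : zero_locus f0 = T by apply/seteqP; split=> // x _ [].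
by have := schwartz_space_smooth_variety sm; rewrite TE.
Qed.

Definition partial_word (w : seq 'I_n) (f : V -> R) : V -> R := foldr (fun i g => partial i g) f w.

Lemma smooth_partial_word w f : smooth_on T f -> smooth_on T (partial_word w f).
Proof. by move=> sf; elim: w => //= i w IH; exact: smooth_on_derive. Qed.

Lemma partialD i (f g : V -> R) : smooth_on T f -> smooth_on T g ->
  partial i (fun x => f x + g x) = fun x => partial i f x + partial i g x.
Proof.
move=> sf sg; apply/funext => x.
by rewrite /partial -deriveD //; [exact: smooth_on_derivable sf I|exact: smooth_on_derivable sg I].
Qed.

Lemma partialM i (f g : V -> R) : smooth_on T f -> smooth_on T g ->
  partial i (fun x => f x * g x) = fun x => partial i f x * g x + f x * partial i g x.
Proof.
move=> sf sg; apply/funext => x.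
have := deriveM (smooth_on_derivable (v := delta_mx 0 i) sf (I : T x)) (smooth_on_derivable (v := delta_mx 0 i) sg (I : T x)).
by rewrite -![_ *: _]/(_ * _) addrC (mulrC (g x)).
Qed.

Lemma partial_wordD w (f g : V -> R) : smooth_on T f -> smooth_on T g ->
  partial_word w (fun x => f x + g x) = fun x => partial_word w f x + partial_word w g x.
Proof.
move=> sf sg; elim: w => //= i w ->.
by rewrite partialD //; exact: smooth_partial_word.
Qed.

Lemma partial_wordS w i (f : V -> R) : partial_word (rcons w i) f = partial_word w (partial i f).
Proof. by rewrite /partial_word foldr_rcons. Qed.

(** Rapid decrease with arbitrary polynomial weights and derivatives in arbitrary order;
this form is visibly stable under the operations below. *)
Definition rapidly_decreasing (f : V -> R) : Prop := smooth_on T f /\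
  forall (p : mpoly n R) w, exists B : R, forall x : V, `|meval (x 0) p * partial_word w f x| <= B.

Lemma rapidly_decreasingD f g : rapidly_decreasing f -> rapidly_decreasing g ->
  rapidly_decreasing (fun x => f x + g x).
Proof.
move=> [sf bf] [sg bg]; split=> [|p w]; first exact: smooth_onD openT sf sg.
have [B hB] := bf p w; have [C hC] := bg p w; exists (B + C) => x.
by rewrite partial_wordD // mulrDr (le_trans (ler_normD _ _)) // lerD.
Qed.

Lemma rapidly_decreasing_partial i f : rapidly_decreasing f -> rapidly_decreasing (partial i f).
Proof.
move=> [sf bf]; split=> [|p w]; first exact: smooth_on_derive.
by have := bf p (rcons w i); rewrite partial_wordS.
Qed.

(** Leibniz' rule, by induction on the word of derivatives: the innermost derivative falls
either on the polynomial or on the function. *)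
Lemma rapidly_decreasingM q f : rapidly_decreasing f ->
  rapidly_decreasing (fun x => meval (x 0) q * f x).
Proof.
move=> rf; split=> [|p w].
  by apply: smooth_onM; [exact: openT|exact: smooth_on_meval openT|case: rf].
elim/last_ind: w q f rf => [|w i IH] q f rf.
  have [_ /(_ (p * q) [::])[B hB]] := rf; exists B => x.
  by have := hB x; rewrite mevalM mulrA.
have sq (q' : mpoly n R) : smooth_on T (fun x : V => meval (x 0) q') := smooth_on_meval q' openT.
have [sf _] := rf.
have [B hB] := IH (mderiv i q) f rf.
have [C hC] := IH q (partial i f) (rapidly_decreasing_partial i rf).
exists (B + C) => x; rewrite partial_wordS partialM //.
have E : partial i (fun x : V => meval (x 0) q) = fun x => meval (x 0) (mderiv i q).
  by apply/funext => y; rewrite partial_meval.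
rewrite E partial_wordD; first by rewrite mulrDr (le_trans (ler_normD _ _)) // lerD.
  exact: smooth_onM openT (sq _) sf.
exact: smooth_onM openT (sq _) (smooth_on_derive _ sf).
Qed.

Lemma rapidly_decreasing_sum I (r : seq I) (f : I -> V -> R) : rapidly_decreasing (fun=> 0) ->
  (forall i, rapidly_decreasing (f i)) -> rapidly_decreasing (fun x => \sum_(i <- r) f i x).
Proof.
move=> r0 rf; elim: r => [|i r IH].
  by rewrite (_ : (fun x => _) = fun=> 0) //; apply/funext => x; rewrite big_nil.
rewrite (_ : (fun x => _) = fun x => f i x + \sum_(j <- r) f j x); first exact: rapidly_decreasingD.
by apply/funext => x; rewrite big_cons.
Qed.

Lemma partial_comm i j (f : V -> R) : smooth_on T f -> partial i (partial j f) = partial j (partial i f).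
Proof. by move=> sf; apply/funext => x; apply: (derive_comm _ _ openT I sf). Qed.

Let fold_partials (b : multinom n) (s : seq 'I_n) (f : V -> R) : V -> R :=
  foldr (fun i => iter (b i) (partial i)) f s.

Let smooth_fold b s f : smooth_on T f -> smooth_on T (fold_partials b s f).
Proof.
move=> sf; elim: s => //= i s IH; elim: (b i) => //= m IHm.
exact: smooth_on_derive.
Qed.

(* The new derivative commutes with those in other directions until it meets its own. *)
Let partial_fold b s f i : smooth_on T f -> uniq s -> i \in s ->
  partial i (fold_partials b s f) = fold_partials (mnm_add b (mnm1 i)) s f.
Proof.
move=> sf; elim: s => //= j s IH /andP[js us]; rewrite inE => /orP[/eqP ij|is_].
  have -> : fold_partials (mnm_add b (mnm1 i)) s f = fold_partials b s f.
    elim: s js {IH us} => //= l s IH; rewrite inE negb_or => /andP[jl js].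
    by rewrite IH // mnmDE mnm1E ij (negbTE jl) addn0.
  by rewrite mnmDE mnm1E ij eqxx addn1 iterS.
have ij : (i == j) = false by apply/eqP => ij; rewrite -ij is_ in js.
rewrite mnmDE mnm1E ij addn0 -IH //.
elim: (b j) => //= m <-; rewrite partial_comm //.
by elim: m => [|m IHm]; [exact: smooth_fold|exact: smooth_on_derive].
Qed.

Lemma partial_word_partials w (f : V -> R) : smooth_on T f ->
  exists b : multinom n, partial_word w f = partials b f.
Proof.
move=> sf; elim: w => [|i w [b IH]] /=.
  exists mnm0; rewrite /partials; elim: (enum _) => //= i s <-.
  by rewrite mnm0E.
by exists (mnm_add b (mnm1 i)); rewrite IH; apply: partial_fold; rewrite ?enum_uniq ?mem_enum.
Qed.

Lemma classical_rapidly_decreasing f : classical_schwartz R n f -> rapidly_decreasing f.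
Proof.
move=> [sf bf]; split=> // p w; have [b ->] := partial_word_partials w sf.
elim/mpolyind: p => [|c m p _ _ [B hB]].
  by exists 0 => x; rewrite meval0 mul0r normr0.
have [C [_ /(_ (C + 1))hC]] := bf m b.
exists (`|c| * (C + 1) + B) => x; rewrite mevalD mulrDl (le_trans (ler_normD _ _)) // lerD //.
rewrite mevalZ mevalX -mulrA normrM ler_wpM2l //.
by apply: hC => //; rewrite ltrDl.
Qed.

Let inT (x : V) : T := SigSub (mem_set (I : T x)).
Let ext (phi : Cinf T) (x : V) : R := phi (inT x).

Let ext_val (phi : Cinf T) (x : T) : ext phi (val x) = phi x.
Proof. by congr (Cinf_fun phi _); exact: val_inj. Qed.

Let smooth_ext phi : smooth_on T (ext phi).
Proof.
apply: smooth_on_local => x _; have [U [F [oU Ux sF FE]]] := Cinf_smooth phi (inT x).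
by exists U, F; split=> // y Uy; rewrite -[y]/(val (inT y)) FE ?ext_val.
Qed.

Let extension_ext (phi : Cinf T) (x : T) : local_extension phi x T (ext phi).
Proof. by split=> [|//||y _]; [exact: openT|exact: smooth_ext|exact: ext_val]. Qed.

Lemma algebraic_diffop_rapidly_decreasing D phi : algebraic_diffop D ->
  rapidly_decreasing (ext phi) -> rapidly_decreasing (ext (D phi)).
Proof.
move=> aD; elim: aD phi => {D} [D [[g [p gp] gD]|[v [pv tv] vD]]||D1 D2 D _ IH1 _ IH2 DE|a D1 D _ IH DE|D1 D2 _ IH1 _ IH2] phi rphi.
- rewrite (_ : ext (D phi) = fun x => meval (x 0) p * ext phi x); first exact: rapidly_decreasingM.
  by apply/funext => x; rewrite /ext gD gp.
- have [p pvE] := choice pv.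
  have r0 : rapidly_decreasing (fun=> 0).
    have := rapidly_decreasingM 0 rphi; congr rapidly_decreasing.
    by apply/funext => x; rewrite meval0 mul0r.
  have := rapidly_decreasing_sum (index_enum 'I_n) r0
    (fun i => rapidly_decreasingM (p i) (rapidly_decreasing_partial i rphi)).
  congr rapidly_decreasing; apply/funext => x.
  rewrite {2}/ext (vD phi (inT x) T (ext phi) (extension_ext phi _)).
  rewrite (derive_partials _ openT I (smooth_ext phi)).
  by apply: eq_bigr => i _; rewrite pvE.
- exact: rphi.
- rewrite (_ : ext (D phi) = fun x => ext (D1 phi) x + ext (D2 phi) x).
    by apply: rapidly_decreasingD; [exact: IH1|exact: IH2].
  by apply/funext => x; rewrite /ext DE.
- have := rapidly_decreasingM (mpolyC n a) (IH phi rphi); congr rapidly_decreasing.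
  by apply/funext => x; rewrite mevalC /ext DE.
- exact: IH1 (IH2 _ rphi).
Qed.

Let axis_derivation : exists D : 'I_n -> Cinf T -> Cinf T,
  forall i, algebraic_diffop (D i) /\ forall phi, ext (D i phi) = partial i (ext phi).
Proof.
pose e i (x : T) : V := delta_mx 0 i.
have ae i : algebraic_vector_field (e i).
  split=> [j|x]; first by exists (mpolyC n (e i (inT 0) 0 j)) => x; rewrite mevalC.
  have b_derive : is_derive (0 : R) 1 (fun t : R => val x + t *: delta_mx 0 i) (e i x).
    apply: is_derive_cvg; apply: cvg_near_cst; near=> t.
    have t0 : t != 0 by near: t; exact: nbhs_dnbhs_neq.
    rewrite -[t%:A]/(t * 1) mulr1 addr0 scale0r addr0 (addrC (val x)) addrK.
    by rewrite scalerA mulVf // scale1r.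
  exists setT, (fun t : R => val x + t *: delta_mx 0 i); split=> //.
  - by split=> //; exact: openT.
  - apply/smooth_on_mxP => [|k j]; first exact: openT.
    rewrite (_ : (fun t => _) = fun t : R => val x k j + t * (delta_mx 0 i : V) k j); last first.
      by apply/funext => t; rewrite !mxE.
    have oT : open [set: R] := openT.
    exact: smooth_onD oT (smooth_on_cst _ oT) (smooth_onM oT (smooth_on_id oT) (smooth_on_cst _ oT)).
  - by rewrite scale0r addr0.
  - by rewrite derive1E; have [_ ->] := b_derive.
have /choice[D DP] := fun i => derivation_exists (ae i).
exists D => i; split; first by apply: gen_base; right; exists (e i).
move=> phi; apply/funext => x.
by rewrite {1}/ext (DP i phi (inT x) T (ext phi) (extension_ext phi _)).
Unshelve. all: end_near. Qed.

(** The operator [x^a partial^b] is algebraic, being composed of multiplications and of the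
derivations along the constant fields of the axes. *)
Lemma algebraic_bounded_classical (phi : Cinf T) :
  (forall D, algebraic_diffop D -> bounded_fun (D phi)) -> classical_schwartz R n (ext phi).
Proof.
move=> bD; split; first exact: smooth_ext.
move=> a b; have [D DP] := axis_derivation.
pose Db := foldr (fun i E => iter (b i) (fun E' => D i \o E') E) idfun (enum 'I_n).
have [aDb DbE] : algebraic_diffop Db /\ forall phi, ext (Db phi) = partials b (ext phi).
  rewrite /Db /partials; elim: (enum _) => [|i s [aE EE]] /=; first by split=> //; exact: gen_one.
  elim: (b i) => [//|m [aE' E'E]] /=; have [aD DE] := DP i; split; first exact: gen_comp.
  by move=> psi; rewrite -E'E -DE.
have sp : smooth (fun x : T => meval (val x 0) (mpolyX R a)) :=
  smooth_restrict (smooth_on_meval (mpolyX R a) openT).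
have apD : algebraic_diffop (mulC sp \o Db).
  apply: gen_comp => //; apply: gen_base; left; exists (fun x : T => meval (val x 0) (mpolyX R a)) => //.
  by exists (mpolyX R a).
have [B [Br hB]] := bD _ apD; exists B; split=> // B' BB' x _.
have := hB B' BB' (inT x) I; rewrite /= mevalX -[Db phi (inT x)]/(ext (Db phi) x) DbE.
by [].
Qed.

Lemma schwartz_space_classical :
  [set Cinf_fun phi | phi in schwartz_space T] =
  [set (fun x : T => f (val x)) | f in classical_schwartz R n].
Proof.
rewrite schwartz_space_full; apply/seteqP; split=> [_ [phi /= bD <-]|_ [f cf <-]].
  exists (ext phi); first exact: algebraic_bounded_classical.
  by apply/funext => x; exact: ext_val.
have [sf _] := cf; pose phi : Cinf T := MkCinf (smooth_restrict (M := T) sf).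
exists phi => //= D aD.
have rphi : rapidly_decreasing (ext phi) := classical_rapidly_decreasing cf.
have [_ /(_ 1 [::])[B hB]] := algebraic_diffop_rapidly_decreasing aD rphi.
apply/bounded_funP; exists B => x; have := hB (val x).
by rewrite meval1 mul1r /= ext_val.
Qed.

End ClassicalSchwartz.

Theorem corollary4p1p3 (R : realType) :
  (forall (n k : nat) (f : 'I_k -> mpoly n R), smooth_variety f ->
     schwartz_space (zero_locus f) =
     [set phi | forall D, algebraic_diffop D -> bounded_fun (D phi)]) /\
  (forall n : nat,
     [set Cinf_fun phi | phi in schwartz_space [set: 'rV[R]_n]] =
     [set (fun x : [set: 'rV[R]_n] => f (val x)) | f in classical_schwartz R n]).
Proof.
split=> [n k f|n]; first exact: schwartz_space_smooth_variety.
exact: schwartz_space_classical.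
Qed.
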